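(* Let $(X_k)_{k\in\mathbb Z}$ be a $\phi$-mixing stationary process on a finite alphabet $A$, with law $\mu$ compatible with a transition kernel $P$, satisfying $$\Phi:=\sum_{k=0}^\infty\phi_k<\infty\qquad\text{and}\qquad\exists\lambda<1:\ \forall(\omega,a)\in A^{-\mathbb N}\times A,\ P(a|\omega)\le\lambda .$$ Let $d_n\le n-1$, $q_n\le(n-1)/4$, $t\in\{n-1,n\}$ and assume that $r_n:=d_n+q_n\le t$. Let $L_\star=4\left(\Phi+\frac1{1-\lambda}\right)$. There exists an event $\Omega_{coup}$ satisfying $\mathbb P(\Omega_{coup}^c)\le2n^2\beta_{q_n}$ such that, for all $y>0$ and all words $\omega\in A^{(d_n+1)}=\bigcup_{k=1}^{d_n+1}A^k$, $$\mathbb P\left(\left\{|\widehat\mu_t(\omega)-\mu(\omega)|>L_\star\sqrt{\frac{\mu(\omega)y}{n-|\omega|+1}}+\frac{(d_n+r_n)y}{n-|\omega|+1}\right\}\cap\Omega_{coup}\right)\le4e^{-y}.$$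
   Context: $A^{-\mathbb N}$ is the set of semi-infinite sequences $a_{-\infty}^{-1}$ with values in $A$; $|\omega|$ is the length of the word $\omega$; $\mu(\omega)=\mathbb P(X_1^{|\omega|}=\omega)$. Compatibility: $P(a|\omega)=\mu(X_0=a|X_{-\infty}^{-1}=\omega)$. The empirical measure from $X_1^n$ is $\widehat\mu_t(\omega)=\frac1{n-|\omega|+1}\sum_{k=|\omega|}^t\mathbf 1_{X_{k-|\omega|+1}^k=\omega}$. Mixing coefficients: for $\sigma$-algebras $\mathcal A,\mathcal B$, $\beta(\mathcal A,\mathcal B)=\frac12\sup\sum_{i=1}^I\sum_{j=1}^J|\mathbb P(A_i\cap B_j)-\mathbb P(A_i)\mathbb P(B_j)|$, the supremum being over finite partitions $(A_i)$, $(B_j)$ of the probability space with $A_i\in\mathcal A$, $B_j\in\mathcal B$, and $\phi(\mathcal A,\mathcal B)=\sup_{A\in\mathcal A,\mathbb P(A)>0}\sup_{B\in\mathcal B}\{\mathbb P(B|A)-\mathbb P(B)\}$. Set $\beta_k=\beta(\sigma(X_i,i\le0),\sigma(X_i,i\ge k))$ and $\phi_k=\phi(\sigma(X_i,i\le0),\sigma(X_i,i\ge k))$. The process is $\phi$-mixing if $\phi_k\to0$. *)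

(* Defs.v *)
From mathcomp Require Import all_boot all_order all_algebra.
From mathcomp Require Import all_classical all_reals all_analysis.

Set Implicit Arguments.
Unset Strict Implicit.
Unset Printing Implicit Defensive.

Import Order.TTheory GRing.Theory Num.Theory.
Import numFieldNormedType.Exports.

Local Open Scope classical_set_scope.
Local Open Scope ring_scope.

(** The sigma-algebra on [U] generated by the [A]-valued maps [f i], [i] in
    [J], where the finite alphabet [A] carries the discrete sigma-algebra. *)
Definition sigma_of (A : finType) (I U : Type) (f : I -> U -> A) (J : set I) :
    set (set U) :=
  <<s \bigcup_(i in J) preimage_set_system setT (f i) setT >>.

(** Pasts in A^{-N} are functions [nat -> A]: [w j] is the letter at time
    [- (j + 1)], so [w 0] is the most recent one. *)
Definition past_sigma (A : finType) : set (set (nat -> A)) :=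
  sigma_of (fun (j : nat) (w : nat -> A) => w j) setT.

Record transition_kernel (R : realType) (A : finType)
    (K : (nat -> A) -> A -> R) : Prop := {
  kernel_ge0 : forall w a, 0 <= K w a ;
  kernel_sum1 : forall w, \sum_(a : A) K w a = 1 ;
  kernel_measurable : forall a (U : set R), measurable U ->
    past_sigma ((fun w => K w a) @^-1` U) }.

Section Process.
Context (R : realType) (A : finType) (d : measure_display)
  (T : measurableType d) (P : probability T R) (X : int -> T -> A).

Definition is_process : Prop :=
  forall (i : int) (B : set A), measurable (X i @^-1` B).

(** Shift-invariance of the finite-dimensional distributions. *)
Definition stationary : Prop :=
  forall (h : int) (m : nat) (i : 'I_m -> int) (a : 'I_m -> A),
    P (\bigcap_(j in [set: 'I_m]) X (i j + h) @^-1` [set a j]) =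
    P (\bigcap_(j in [set: 'I_m]) X (i j) @^-1` [set a j]).

Definition past (x : T) : nat -> A := fun j => X (- (j.+1)%:Z) x.

(** [K w a] is a version of the conditional probability that X_0 = a given
    that the past X_{-oo}^{-1} is [w]. *)
Definition compatible (K : (nat -> A) -> A -> R) : Prop :=
  forall (a : A) (B : set (nat -> A)), past_sigma B ->
    P (X 0 @^-1` [set a] `&` past @^-1` B) =
    (\int[P]_(x in past @^-1` B) (K (past x) a)%:E)%E.

(** The word X_s^{s + l - 1}. *)
Definition segment (s : int) (l : nat) (x : T) : seq A :=
  mkseq (fun i => X (s + i%:Z) x) l.

Definition mu (w : seq A) : R :=
  fine (P [set x | segment 1 (size w) x = w]).

Definition mu_hat (n t : nat) (w : seq A) (x : T) : R :=
  (n%:R - (size w)%:R + 1)^-1 *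
  \sum_(size w <= k < t.+1)
    (segment (k%:Z - (size w)%:Z + 1) (size w) x == w)%:R.

Definition beta_coef (F G : set (set T)) : \bar R :=
  ((2^-1 : R)%:E * ereal_sup [set s : \bar R |
    exists (I J : nat) (E : 'I_I -> set T) (H : 'I_J -> set T),
      [/\ partition setT E setT /\ (forall i, F (E i)),
          partition setT H setT /\ (forall j, G (H j)) &
          s = (\sum_(i < I) \sum_(j < J)
                `|fine (P (E i `&` H j))
                  - fine (P (E i)) * fine (P (H j))|)%R%:E]])%E.

Definition phi_coef (F G : set (set T)) : \bar R :=
  ereal_sup [set s : \bar R | exists E H : set T,
    [/\ F E, (0 < P E)%E, G H &
        s = (fine (P (E `&` H)) / fine (P E) - fine (P H))%:E]].

Definition sigma_le (k : int) : set (set T) :=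
  sigma_of X [set i | i <= k].

Definition sigma_ge (k : int) : set (set T) :=
  sigma_of X [set i | k <= i].

Definition beta (k : nat) : \bar R := beta_coef (sigma_le 0) (sigma_ge k%:Z).

Definition phi (k : nat) : \bar R := phi_coef (sigma_le 0) (sigma_ge k%:Z).

Definition phi_mixing : Prop := phi k @[k --> \oo] --> 0%E.

Definition Phi : \bar R := (\sum_(0 <= k <oo) phi k)%E.

Definition L_star (lambda : R) : R := 4 * (fine Phi + (1 - lambda)^-1).

End Process.

(* Main.v *)
Require Import Defs.
From mathcomp Require Import all_boot all_order all_algebra.
From mathcomp Require Import all_classical all_reals all_analysis.
From mathcomp Require Import measurable_realfun ring lra zify.

Set Implicit Arguments.
Unset Strict Implicit.
Unset Printing Implicit Defensive.

Import Order.TTheory GRing.Theory Num.Theory.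
Import numFieldNormedType.Exports.

Local Open Scope classical_set_scope.
Local Open Scope ring_scope.

(** Cut the sample into alternating even and odd blocks of [B = d + q]
    consecutive end points; blocks of the same parity depend on stretches of
    [X] at least [q] apart, so by telescoping the law [nu] of such a row of
    blocks is within [2 n beta_q] of the product [nu*] of its marginals in L1.
    No coupling is constructed on the given space: [Omega_coup] is the event
    that the observed rows [z] of both parities satisfy [nu z <= 2 nu* z].
    Its complement has probability at most [4 n beta_q], and on it every
    probability is at most twice the one for independent blocks.  There
    Bernstein's inequality applies at level [3 y / 2], since
    [8 e^(- 3 y / 2) <= 4 e^(- y)] whenever [4 e^(- y) <= 1]; its linear term
    is [B y / 2] for each parity.  The variance of a block count is summed
    from covariances, at most [mu lambda^h] for overlapping occurrences and
    [mu phi_(h - l + 1)] for disjoint ones.  If [2 n^2 beta_q >= 1],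
    [Omega_coup] is empty.  *)

(** * Bernstein's inequality on a finite product space *)

(** Only the sign of the intermediate point is kept: [0 <= c * x] puts it on the side of [x],
    whatever the sign of [x]. Two applications then chain into a sign for a second-order
    remainder. *)
Lemma MVT_origin (R : realType) (f f' : R -> R) (x : R) :
  (forall u : R, is_derive u 1 f (f' u)) ->
  exists2 c, 0 <= c * x & f x - f 0 = f' c * x.
Proof.
move=> df; have cf : continuous f.
  by move=> u; apply/differentiable_continuous/derivable1_diffP.
have cfA (A : set R) : {within A, continuous f} by exact: continuous_subspaceT.
case: (leP 0 x) => x0.
  have [c] := MVT_segment x0 (fun u _ => df u) (cfA _).
  by rewrite in_itv/= subr0 => /andP[c0 _]; exists c => //; exact: mulr_ge0.
have [c] := MVT_segment (ltW x0) (fun u _ => df u) (cfA _).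
rewrite in_itv/= sub0r => /andP[_ c0] E; exists c; first by rewrite mulr_le0// ltW.
by rewrite -opprB E mulrN opprK.
Qed.

(* The difference of the two sides vanishes to second order at [0] and has
   second derivative [expR u * (1 - u) - 1 <= 0], up to a factor 3. *)
Lemma expR_pade_le (R : realType) (u : R) :
  expR u * (1 - u / 3) <= 1 + 2 / 3 * u + u ^+ 2 / 6.
Proof.
pose h (v : R) := expR v * (1 - 3^-1 * v) - (1 + 2 / 3 * v + 6^-1 * v ^+ 2).
pose h1 (v : R) := expR v * (2 / 3 - 3^-1 * v) - (2 / 3 + 3^-1 * v).
pose h2 (v : R) := expR v * (3^-1 - 3^-1 * v) - 3^-1.
have dh (v : R) : is_derive v 1 h (h1 v).
  rewrite /h; apply: is_derive_eq.
  by rewrite /h1 /GRing.scale/=; field.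
have dh1 (v : R) : is_derive v 1 h1 (h2 v).
  rewrite /h1; apply: is_derive_eq.
  by rewrite /h2 /GRing.scale/=; field.
have h2_le0 v : h2 v <= 0.
  have e1 := expR_ge1Dx (- v); have e2 := expR_gt0 v.
  have e3 : expR v * expR (- v) = 1 by rewrite -expRD subrr expR0.
  have : expR v * (1 - v) <= expR v * expR (- v) by rewrite ler_pM2l.
  by rewrite e3 /h2; lra.
have [c cu hc] := MVT_origin u dh; have [e ec he] := MVT_origin c dh1.
have h0 : h 0 = 0 by rewrite /h expR0; field.
have h10 : h1 0 = 0 by rewrite /h1 expR0; field.
have : h u <= 0.
  by move: hc he; rewrite h0 h10 !subr0 => -> ->; rewrite -mulrA mulr_le0_ge0.
rewrite /h subr_le0; lra.
Qed.

(** Dividing the Pade bound by [1 - u / 3 > 0] gives the claim with [u] in place of [a]; the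
    quadratic coefficient increases with [a]. *)
Lemma expR_bernstein_le (R : realType) (a u : R) : u <= a -> a < 3 ->
  expR u <= 1 + u + u ^+ 2 / (2 * (1 - a / 3)).
Proof.
move=> ua a3; have e := expR_pade_le u.
have u3 : 0 < 1 - u / 3 by lra.
have a3' : 0 < 1 - a / 3 by lra.
have -> : 1 + u + u ^+ 2 / (2 * (1 - a / 3)) =
   (1 + u + u ^+ 2 / (2 * (1 - u / 3))) +
   (u ^+ 2 / (2 * (1 - a / 3)) - u ^+ 2 / (2 * (1 - u / 3))) by ring.
rewrite -[expR u]addr0 lerD//.
  rewrite -(ler_pM2r u3) (le_trans e)// le_eqVlt; apply/orP; left; apply/eqP.
  by field; lra.
rewrite subr_ge0 ler_wpM2l// ?sqr_ge0// lef_pV2 ?posrE; lra.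
Qed.

Lemma sum_ffun_prod (R : realType) (W : finType) (m : nat)
    (F : 'I_m -> W -> R) :
  \sum_(z : {ffun 'I_m -> W}) \prod_i F i (z i) = \prod_i \sum_w F i w.
Proof. by rewrite bigA_distr_bigA. Qed.

Section bernstein.
Variables (R : realType) (W : finType) (m : nat) (p : W -> R).
Hypotheses (p_ge0 : forall w, 0 <= p w) (p_sum1 : \sum_w p w = 1).
Variables (h : 'I_m -> W -> R) (v : 'I_m -> R) (M : R).
Hypothesis M_gt0 : 0 < M.
Hypothesis h_le : forall i w, h i w <= M.
Hypothesis h_mean : forall i, \sum_w p w * h i w = 0.
Hypothesis h_var : forall i, \sum_w p w * h i w ^+ 2 <= v i.

(** Averaging [expR_bernstein_le]: centring removes the linear term, the variance bounds the
    quadratic one, and [1 + x <= expR x] closes. *)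
Lemma laplace_le (s : R) (i : 'I_m) : 0 <= s -> s * M < 3 ->
  \sum_w p w * expR (s * h i w) <= expR (s ^+ 2 / (2 * (1 - s * M / 3)) * v i).
Proof.
move=> s0 sM; set k := s ^+ 2 / _.
have k0 : 0 <= k by rewrite divr_ge0 ?sqr_ge0//; lra.
apply: le_trans (expR_ge1Dx _).
apply: (@le_trans _ _ (\sum_w (p w + s * (p w * h i w) + k * (p w * h i w ^+ 2)))).
  apply: ler_sum => w _.
  have := @expR_bernstein_le R (s * M) (s * h i w) (ler_wpM2l s0 (h_le i w)) sM.
  move/(ler_wpM2l (p_ge0 w))/le_trans; apply.
  by rewrite /k exprMn le_eqVlt; apply/orP; left; apply/eqP; ring.
rewrite !big_split/= -!mulr_sumr p_sum1 h_mean mulr0 addr0 lerD2l.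
by rewrite ler_wpM2l// h_var.
Qed.

(** Exponential Markov inequality; the exponential moment factorises over the coordinates of the
    product. *)
Lemma chernoff (s u : R) : 0 <= s -> s * M < 3 ->
  \sum_(z : {ffun 'I_m -> W} | u < \sum_i h i (z i)) \prod_i p (z i) <=
  expR (s ^+ 2 / (2 * (1 - s * M / 3)) * (\sum_i v i) - s * u).
Proof.
move=> s0 sM; rewrite big_mkcond/=.
apply: (@le_trans _ _ (\sum_(z : {ffun 'I_m -> W})
    expR (- (s * u)) * \prod_i (p (z i) * expR (s * h i (z i))))).
  apply: ler_sum => z _; rewrite big_split/=.
  have P0 : 0 <= \prod_i p (z i) by apply: prodr_ge0.
  rewrite -expR_sum -mulr_sumr mulrCA -expRD.
  case: ifPn => [uz|_]; last by rewrite mulr_ge0 ?expR_ge0.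
  rewrite ler_peMr// -[leLHS]expR0 ler_expR addrC -mulrBr mulr_ge0// subr_ge0.
  exact: ltW.
rewrite -mulr_sumr (sum_ffun_prod (fun i w => p w * expR (s * h i w))).
rewrite addrC expRD ler_wpM2l ?expR_ge0//.
rewrite mulr_sumr expR_sum; apply: ler_prod => i _.
by rewrite sumr_ge0/= ?laplace_le// => w _; rewrite mulr_ge0 ?expR_ge0.
Qed.

Lemma bernstein (V x : R) : \sum_i v i <= V -> 0 < x ->
  \sum_(z : {ffun 'I_m -> W} | Num.sqrt (2 * V * x) + M * x / 3 < \sum_i h i (z i))
     \prod_i p (z i) <= expR (- x).
Proof.
move=> vV x0.
have v0 i : 0 <= v i.
  by apply: le_trans (h_var i); apply: sumr_ge0 => w _; rewrite mulr_ge0 ?sqr_ge0.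
have V0 : 0 <= V by apply: le_trans vV; apply: sumr_ge0.
(* If [V = 0], each [h i] vanishes on the atoms of positive mass, so every [z] in the event has
   weight 0. *)
move: V0; rewrite le_eqVlt => /predU1P[V0|V0].
  rewrite big1 ?expR_ge0// => z.
  case: (boolP [exists i, p (z i) == 0]) => [/existsP[i pi] _|/existsPn pz].
    by apply/eqP/prodf_eq0; exists i.
  rewrite ltNge big1.
    by rewrite addr_ge0 ?sqrtr_ge0// divr_ge0// mulr_ge0// ltW.
  move=> i _; have vi : v i <= 0.
    by rewrite [leRHS]V0; apply: le_trans vV; rewrite (bigD1 i)//= lerDl sumr_ge0.
  have /eqP : \sum_w p w * h i w ^+ 2 = 0.
    apply/eqP; rewrite eq_le (le_trans (h_var i) vi)/=.
    by apply: sumr_ge0 => w _; rewrite mulr_ge0 ?sqr_ge0.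
  rewrite psumr_eq0; last by move=> w _; rewrite mulr_ge0 ?sqr_ge0.
  move=> /allP/(_ (z i) (mem_index_enum _))/=.
  by rewrite mulf_eq0 (negPf (pz i))/= sqrf_eq0 => /eqP.
(* [a] minimises the Gaussian exponent [s ^+ 2 * V / 2 - s * sqrt (2 * V * x)]. Dividing it by [D]
   makes [1 - s * M / 3] equal to [D^-1], and the exponent becomes exactly [- x]. *)
pose a := Num.sqrt (2 * V * x) / V.
have a0 : 0 < a by rewrite divr_gt0// sqrtr_gt0 !mulr_gt0.
have sE : Num.sqrt (2 * V * x) = a * V by rewrite /a divfK// gt_eqF.
have aV : a ^+ 2 * V = 2 * x.
  rewrite /a expr_div_n sqr_sqrtr; last by rewrite ltW// !mulr_gt0.
  by field; rewrite gt_eqF.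
pose D := 1 + M * a / 3.
have D0 : 0 < D by have := mulr_gt0 M_gt0 a0; rewrite /D; lra.
pose s := a / D.
have s0 : 0 <= s by rewrite divr_ge0// ltW.
have Ma0 := mulr_gt0 M_gt0 a0.
have sME : 1 - s * M / 3 = D^-1.
  by rewrite /s /D; field; rewrite gt_eqF//; lra.
have sM3 : s * M < 3 by have : 0 < D^-1; [rewrite invr_gt0|rewrite -sME; lra].
apply: (le_trans (chernoff _ s0 sM3)); rewrite ler_expR sME sE.
have c0 : 0 <= s ^+ 2 / (2 * D^-1) by rewrite divr_ge0 ?sqr_ge0// mulr_ge0// invr_ge0 ltW.
apply: le_trans (lerB (ler_wpM2l c0 vV) (lexx _)) _.
rewrite le_eqVlt; apply/orP; left; apply/eqP.
have -> : s ^+ 2 / (2 * D^-1) * V - s * (a * V + M * x / 3) =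
  (a ^+ 2 * V / 2 - a ^+ 2 * V - a * M * x / 3) / D.
  by rewrite /s; field; rewrite gt_eqF.
by rewrite aV /D; field; rewrite gt_eqF//; lra.
Qed.

End bernstein.

(** * Finite-valued maps and mixing coefficients *)

Section generated_by_maps.
Variables (A : finType) (I U : Type) (f : I -> U -> A) (J : set I).

Lemma sigma_of_preimage i (B : set A) : J i -> sigma_of f J (f i @^-1` B).
Proof.
move=> Ji; apply: sub_sigma_algebra; exists i => //; exists B => //.
by rewrite setTI.
Qed.

Lemma sigma_of_setT : sigma_of f J setT.
Proof.
by rewrite -(setD0 setT); apply: sigma_algebraCD; exact: sigma_algebra0.
Qed.

Lemma sigma_of_setI E F : sigma_of f J E -> sigma_of f J F ->
  sigma_of f J (E `&` F).
Proof.
have [H _] := @sigma_algebraP U setT (sigma_of f J) (fun _ _ => @subsetT _ _).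
by have [_ _ _] := H (@smallest_sigma_algebra _ _ _); apply.
Qed.

Lemma sigma_of_forall (L : finType) (F : L -> set U) :
  (forall k, sigma_of f J (F k)) -> sigma_of f J [set x | forall k, F k x].
Proof.
move=> FJ; suff H (s : seq L) :
    sigma_of f J [set x | forall k, k \in s -> F k x].
  rewrite (_ : mkset _ = [set x | forall k, k \in enum L -> F k x]).
    exact: H.
  by apply/seteqP; split=> x /= Fx k => [_|]; apply: Fx; rewrite ?mem_enum.
elim: s => [|k s IH].
  rewrite (_ : mkset _ = setT); first exact: sigma_of_setT.
  by apply/seteqP; split.
rewrite (_ : mkset _ = F k `&` [set x | forall k, k \in s -> F k x]).
  exact: sigma_of_setI.
apply/seteqP; split=> x /=.
  by move=> Fx; split=> [|j js]; apply: Fx; rewrite inE ?eqxx// js orbT.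
by move=> [Fk Fs] j; rewrite inE => /predU1P[->//|/Fs].
Qed.

End generated_by_maps.

Section finite_valued.
Context (R : realType) (disp : measure_display) (T : measurableType disp)
  (P : probability T R).
Local Notation pr E := (fine (P E)).

Lemma pr_ge0 E : 0 <= pr E.
Proof. by rewrite fine_ge0. Qed.

Lemma prK E : measurable E -> (pr E)%:E = P E.
Proof. by move=> mE; rewrite fineK// fin_num_measure. Qed.

Lemma pr_le E F : measurable E -> measurable F -> E `<=` F -> pr E <= pr F.
Proof.
by move=> mE mF EF; rewrite -lee_fin !prK// le_measure ?inE.
Qed.

Lemma pr_le1 E : measurable E -> pr E <= 1.
Proof. by move=> mE; rewrite -lee_fin prK// probability_le1. Qed.

Section one_map.
Variables (W : finType) (f : T -> W).
Hypothesis mf : forall w, measurable [set x | f x = w].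

Lemma measurable_finpred (D : pred W) : measurable [set x | D (f x)].
Proof.
rewrite (_ : mkset _ = \bigcup_(w in [set` D]) [set x | f x = w]).
  by apply: fin_bigcup_measurable.
apply/seteqP; split=> [x Dx|x [w /= Dw fxw]]; first by exists (f x).
by rewrite fxw.
Qed.

Lemma pr_finpredI E (D : pred W) : measurable E ->
  pr (E `&` [set x | D (f x)]) = \sum_(w | D w) pr (E `&` [set x | f x = w]).
Proof.
move=> mE; apply: EFin_inj; rewrite prK ?sumEFin; last first.
  by apply: measurableI => //; exact: measurable_finpred.
rewrite (_ : _ `&` _ = \bigcup_(w in [set` D]) (E `&` [set x | f x = w])).
  rewrite measure_fin_bigcup//; last by move=> w _; exact: measurableI.
    rewrite -sumEFin (bigfs _ (r := index_enum W))//.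
    - by apply: eq_fsbigr => w _; rewrite prK//; exact: measurableI.
    - exact: index_enum_uniq.
    - by move=> w _; rewrite mem_index_enum.
  by move=> u v _ _ [x [[_ <-] [_ <-]]].
apply/seteqP; split=> [x [Ex Dx]|x [w /= Dw [Ex fxw]]]; first by exists (f x).
by split=> //=; rewrite fxw.
Qed.

Lemma pr_finpred (D : pred W) :
  pr [set x | D (f x)] = \sum_(w | D w) pr [set x | f x = w].
Proof.
have := pr_finpredI D measurableT; rewrite setTI => ->.
by apply: eq_bigr => w _; rewrite setTI.
Qed.

Lemma pr_fin_sum1 : \sum_w pr [set x | f x = w] = 1.
Proof.
rewrite -(pr_finpred predT) (_ : mkset _ = setT) ?probability_setT//.
by apply/seteqP; split.
Qed.

End one_map.

Lemma beta_coef_ge_fin (U V : finType) (f : T -> U) (g : T -> V)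
    (F G : set (set T)) :
  (forall u, F [set x | f x = u]) -> (forall v, G [set x | g x = v]) ->
  ((2^-1 * \sum_u \sum_v `|pr ([set x | f x = u] `&` [set x | g x = v])
     - pr [set x | f x = u] * pr [set x | g x = v]|)%:E
   <= beta_coef P F G)%E.
Proof.
move=> Ff Gg.
(* Cells of a partition must be nonempty, so only attained values index them; the other values
   contribute zero. *)
pose ne (W : finType) (h : T -> W) := [pred w | `[< [set x | h x = w] !=set0 >]].
have part (W : finType) (h : T -> W) :
    partition [set: 'I_#|ne W h|] (fun i => [set x | h x = enum_val i]) setT.
  split.
  - rewrite -subTset => x _.
    have hx : h x \in ne W h by apply/asboolP; exists x.
    by exists (enum_rank_in hx (h x)) => //=; rewrite enum_rankK_in.
  - by move=> i j _ _ [x [/= -> ]]; exact: enum_val_inj.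
  - by move=> i _; have /asboolP := enum_valP i.
have sumE (W : finType) (h : T -> W) (c : W -> R) :
    (forall w, [set x | h x = w] = set0 -> c w = 0) ->
    \sum_w c w = \sum_(i < #|ne W h|) c (enum_val i).
  move=> c0; rewrite -(big_enum_val (A := ne W h)) [RHS]big_mkcond/=.
  apply: eq_bigr => w _; case: ifPn => // /asboolPn n0.
  by apply: c0; apply/eqP; apply: contra_notT n0 => /set0P.
rewrite EFinM lee_pmul2l// ?lte_fin ?invr_gt0//.
apply: ereal_sup_ubound; exists #|ne U f|, #|ne V g|.
exists (fun i => [set x | f x = enum_val i]), (fun i => [set x | g x = enum_val i]).
split; [by split; [exact: part|move=> i; exact: Ff]|
  by split; [exact: part|move=> i; exact: Gg]|].
congr (_%:E); rewrite (sumE U f) => [|u u0]; last first.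
  by rewrite big1// => v _; rewrite u0 set0I measure0/= mul0r subrr normr0.
apply: eq_bigr => i _; apply: sumE => v v0.
by rewrite v0 setI0 measure0/= mulr0 subrr normr0.
Qed.

Lemma beta_coef_ge0 (F G : set (set T)) : F setT -> G setT ->
  (0 <= beta_coef P F G)%E.
Proof.
move=> FT GT; pose f (x : T) := tt.
have fE u : [set x | f x = u] = setT by case: u; apply/seteqP; split.
apply: le_trans (beta_coef_ge_fin (f := f) (g := f) _ _).
- by rewrite lee_fin mulr_ge0 ?invr_ge0// sumr_ge0// => u _; exact: sumr_ge0.
- by move=> u; rewrite fE.
- by move=> u; rewrite fE.
Qed.

Lemma phi_coef_ge (F G : set (set T)) E H : F E -> G H ->
  measurable E -> measurable H -> 0 < pr E -> phi_coef P F G \is a fin_num ->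
  pr (E `&` H) <= pr E * (fine (phi_coef P F G) + pr H).
Proof.
move=> FE GH mE mH E0 pfin; rewrite mulrC -ler_pdivrMr// -lerBlDr.
rewrite -lee_fin fineK//; apply: ereal_sup_ubound; exists E, H; split=> //.
by rewrite -prK// lte_fin.
Qed.

Lemma phi_coef_ge0 (F G : set (set T)) : F setT -> G setT ->
  (0 <= phi_coef P F G)%E.
Proof.
move=> FT GT; apply: ereal_sup_ubound; exists setT, setT; split=> //.
  by rewrite probability_setT lte_fin.
by rewrite setIT probability_setT/= divr1 subrr.
Qed.

End finite_valued.

(** * Blocks of a stationary process *)

Section blocks.
Context (A : finType) (disp : measure_display) (T : measurableType disp)
  (X : int -> T -> A).

(** Tuples make the values of a block a finite type, so that laws of blocks and of rows of blocks
    are finite sums. *)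
Definition block (s : int) (b : nat) (x : T) : b.-tuple A :=
  [tuple X (s + (i : nat)%:Z) x | i < b].

Definition block_row (s : int) (D m b : nat) (x : T) :
    {ffun 'I_m -> b.-tuple A} :=
  [ffun i : 'I_m => block (s + (D * i)%:Z) b x].

Lemma val_block s b x : block s b x = segment X s b x :> seq A.
Proof.
by rewrite /= /segment /mkseq -val_enum_ord -map_comp.
Qed.

Lemma block_eq s b (w : b.-tuple A) :
  [set x | block s b x = w] =
  [set x | forall i : 'I_b, (X (s + (i : nat)%:Z) @^-1` [set tnth w i]) x].
Proof.
apply/seteqP; split=> x /= Xw; first by rewrite -Xw => i; rewrite tnth_mktuple.
by apply: eq_from_tnth => i; rewrite tnth_mktuple Xw.
Qed.

Lemma block_row_eq s D m b (z : {ffun 'I_m -> b.-tuple A}) :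
  [set x | block_row s D m b x = z] =
  [set x | forall i : 'I_m, block (s + (D * i)%:Z) b x = z i].
Proof.
by apply/seteqP; split=> x /= => [<- i|H]; [|apply/ffunP => i]; rewrite ffunE.
Qed.

Lemma sigma_of_block (J : set int) s b (w : b.-tuple A) :
  (forall i : nat, (i < b)%N -> J (s + i%:Z)) ->
  sigma_of X J [set x | block s b x = w].
Proof.
move=> sJ; rewrite block_eq; apply: sigma_of_forall => i.
exact: sigma_of_preimage (sJ _ (ltn_ord i)).
Qed.

Lemma sigma_of_block_row (J : set int) s D m b (z : {ffun 'I_m -> b.-tuple A}) :
  (forall i j : nat, (i < m)%N -> (j < b)%N -> J (s + (D * i)%:Z + j%:Z)) ->
  sigma_of X J [set x | block_row s D m b x = z].
Proof.
move=> sJ; rewrite block_row_eq.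
apply: (sigma_of_forall (F := fun (i : 'I_m) =>
  [set x | block (s + (D * i)%:Z) b x = z i])) => i.
by apply: sigma_of_block => j jb; exact: sJ.
Qed.

End blocks.

Section stationary_process.
Context (R : realType) (A : finType) (disp : measure_display)
  (T : measurableType disp) (P : probability T R) (X : int -> T -> A).
Hypotheses (hX : is_process X) (hstat : stationary P X).
Local Notation pr E := (fine (P E)).
Local Notation block := (block X).
Local Notation block_row := (block_row X).

Lemma sigma_of_measurable (J : set int) E : sigma_of X J E -> measurable E.
Proof.
apply: smallest_sub; first exact: sigma_algebra_measurable.
by move=> _ [i _ [B _ <-]]; rewrite setTI; exact: hX.
Qed.

Lemma measurable_block s b (w : b.-tuple A) :
  measurable [set x | block s b x = w].
Proof. exact: (sigma_of_measurable (sigma_of_block (J := setT) _ _)). Qed.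

Lemma measurable_block_row s D m b (z : {ffun 'I_m -> b.-tuple A}) :
  measurable [set x | block_row s D m b x = z].
Proof. exact: (sigma_of_measurable (sigma_of_block_row (J := setT) _ _)). Qed.

(** An arbitrary finite index type accommodates pairs of a block and a position in it, as rows of
    blocks require. *)
Lemma stationary_fin (I : finType) (h : int) (i : I -> int) (a : I -> A) :
  P [set x | forall j, X (i j + h) x = a j] =
  P [set x | forall j, X (i j) x = a j].
Proof.
have E (k : I -> int) : [set x | forall j, X (k j) x = a j] =
    \bigcap_(j in [set: 'I_#|I|]) X (k (enum_val j)) @^-1` [set a (enum_val j)].
  apply/seteqP; split=> x /= Xa j; first by move=> _; exact: Xa.
  by have := Xa (enum_rank j) Logic.I; rewrite /= enum_rankK.
by rewrite (E (fun j => i j + h)) E hstat.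
Qed.

Lemma block_shift s h b (w : b.-tuple A) :
  pr [set x | block (s + h) b x = w] = pr [set x | block s b x = w].
Proof.
have := congr1 fine (stationary_fin h (fun i : 'I_b => s + (i : nat)%:Z) (tnth w)).
rewrite !block_eq => <-; congr (fine (P _)).
by apply/seteqP; split=> x /= Xw i; rewrite -(Xw i) addrAC.
Qed.

Lemma block_row_shift s h D m b (z : {ffun 'I_m -> b.-tuple A}) :
  pr [set x | block_row (s + h) D m b x = z] =
  pr [set x | block_row s D m b x = z].
Proof.
have E u : [set x | block_row u D m b x = z] = [set x | forall k : 'I_m * 'I_b,
    X (u + (D * k.1)%:Z + (k.2 : nat)%:Z) x = tnth (z k.1) k.2].
  rewrite block_row_eq; apply/seteqP; split=> x /= Xz.
    by move=> [i j]/=; rewrite -Xz tnth_mktuple.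
  by move=> i; apply: eq_from_tnth => j; rewrite -(Xz (i, j)) tnth_mktuple.
have := congr1 fine (stationary_fin h (fun k : 'I_m * 'I_b =>
  s + (D * k.1)%:Z + (k.2 : nat)%:Z) (fun k => tnth (z k.1) k.2)).
rewrite !E => <-; congr (fine (P _)).
apply/seteqP; split=> x /= Xz k; rewrite -(Xz k); congr (X _ x); ring.
Qed.

Lemma mu_block s b (w : b.-tuple A) :
  mu P X w = pr [set x | block s b x = w].
Proof.
rewrite -(subrK 1 s) addrC block_shift /mu size_tuple; congr (fine (P _)).
apply/seteqP; split=> x /= Xw; last by rewrite -Xw val_block.
by apply: val_inj; rewrite /= val_block.
Qed.

Lemma mu_segment s (w : seq A) :
  mu P X w = pr [set x | segment X s (size w) x = w].
Proof.
rewrite -[w]/(tval (in_tuple w)) (mu_block s); congr (fine (P _)).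
apply/seteqP; split=> x /= Xw; first by rewrite -val_block Xw.
by apply: val_inj; rewrite /= val_block.
Qed.

Lemma measurable_segment s l (w : seq A) : measurable [set x | segment X s l x = w].
Proof.
have [wl|/eqP wl] := eqVneq (size w) l.
  rewrite (_ : mkset _ = [set x | block s l x = Tuple (introT eqP wl)]).
    exact: measurable_block.
  apply/seteqP; split=> x /= Xw; first by apply: val_inj; rewrite /= val_block.
  by rewrite -val_block Xw.
rewrite (_ : mkset _ = set0)//; apply/seteqP; split=> x //= Xw.
by apply: wl; rewrite -Xw size_mkseq.
Qed.

Lemma mu_ge0 w : 0 <= mu P X w. Proof. exact: pr_ge0. Qed.

Lemma mu_le1 w : mu P X w <= 1.
Proof. by apply: pr_le1; exact: measurable_segment. Qed.

Lemma sum_mu_pred (s : int) b (D : pred (b.-tuple A)) :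
  \sum_(w | D w) mu P X w = pr [set x | D (block s b x)].
Proof.
rewrite (pr_finpred _ (@measurable_block s b)).
by apply: eq_bigr => w _; rewrite (mu_block s).
Qed.

Lemma sum_mu1 b : \sum_(w : b.-tuple A) mu P X w = 1.
Proof.
rewrite -(pr_fin_sum1 P (@measurable_block 0 b)).
by apply: eq_bigr => w _; rewrite (mu_block 0).
Qed.

End stationary_process.

(** * Approximate independence of separated blocks *)

Lemma sum_ffun_recr (R : realType) (W : finType) (m : nat)
    (F : {ffun 'I_m.+1 -> W} -> R) :
  \sum_z F z = \sum_(z : {ffun 'I_m -> W}) \sum_(w : W)
    F [ffun i => if unlift ord_max i is Some j then z j else w].
Proof.
pose ext (u : {ffun 'I_m -> W} * W) : {ffun 'I_m.+1 -> W} :=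
  [ffun i => if unlift ord_max i is Some j then u.1 j else u.2].
pose res (z : {ffun 'I_m.+1 -> W}) : {ffun 'I_m -> W} * W :=
  ([ffun j => z (lift ord_max j)], z ord_max).
rewrite pair_bigA/= (reindex ext)//=; exists res => [[z w] _|z _].
  rewrite /res /ext; congr pair; last by rewrite ffunE unlift_none.
  by apply/ffunP => j; rewrite !ffunE liftK.
apply/ffunP => i; rewrite !ffunE.
by case: unliftP => [j ->|->]//=; rewrite ffunE.
Qed.

Section decoupling.
Context (R : realType) (A : finType) (disp : measure_display)
  (T : measurableType disp) (P : probability T R) (X : int -> T -> A).
Hypotheses (hX : is_process X) (hstat : stationary P X).
Local Notation pr E := (fine (P E)).
Local Notation block := (block X).
Local Notation block_row := (block_row X).
Variables (D b q : nat).
Hypothesis gap : (b + q <= D.+1)%N.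
Hypothesis beta_fin : beta P X q \is a fin_num.

Definition row_law (m : nat) (z : {ffun 'I_m -> b.-tuple A}) : R :=
  pr [set x | block_row 0 D m b x = z].

Definition product_law (m : nat) (z : {ffun 'I_m -> b.-tuple A}) : R :=
  \prod_i mu P X (z i).

Lemma row_lawE s m z : row_law z = pr [set x | block_row s D m b x = z].
Proof. by rewrite -[s]add0r (block_row_shift hstat). Qed.

Lemma product_law_ge0 m (z : {ffun 'I_m -> b.-tuple A}) : 0 <= product_law z.
Proof. by apply: prodr_ge0 => i _; exact: mu_ge0. Qed.

Lemma sum_product_law m : \sum_(z : {ffun 'I_m -> b.-tuple A}) product_law z = 1.
Proof.
rewrite (sum_ffun_prod (fun _ (w : b.-tuple A) => mu P X w)).
by rewrite big1// => i _; exact: sum_mu1.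
Qed.

Lemma sum_row_law m : \sum_(z : {ffun 'I_m -> b.-tuple A}) row_law z = 1.
Proof. by apply: pr_fin_sum1 => z; exact: measurable_block_row. Qed.

(** The first [m] blocks and the next one are finite-valued maps on either side of a gap [q]; the
    factor 2 undoes the [1/2] in the definition of beta. *)
Lemma row_law_recr_beta m :
  \sum_(z : {ffun 'I_m -> b.-tuple A}) \sum_(w : b.-tuple A)
    `|row_law [ffun i => if unlift ord_max i is Some j then z j else w]
      - row_law z * mu P X w| <= 2 * fine (beta P X q).
Proof.
(* With this start the [m]-th block ends at time 0, and the next one begins at [1 - b + D], which is
   at least [q] by [gap]. *)
pose s : int := 1 - b%:Z + D%:Z - (D * m)%:Z.
pose f := block_row s D m b; pose g := block (s + (D * m)%:Z) b.
have mf z : sigma_le X 0 [set x | f x = z].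
  apply: sigma_of_block_row => i j im jb /=.
  have : (D * i.+1 <= D * m)%N by rewrite leq_mul2l im orbT.
  by rewrite /s mulnS; lia.
have mg w : sigma_ge X q%:Z [set x | g x = w].
  by apply: sigma_of_block => i ib /=; rewrite /s; lia.
have := beta_coef_ge_fin P mf mg.
rewrite -/(beta P X q) -(fineK beta_fin) lee_fin => le_beta.
rewrite -ler_pdivrMl//; apply: le_trans le_beta; rewrite ler_pM2l ?invr_gt0//.
apply: ler_sum => z _; apply: ler_sum => w _; rewrite -(mu_block hstat).
rewrite -!(row_lawE s) le_eqVlt; apply/orP; left; apply/eqP.
congr (`|_ - _|); rewrite (row_lawE s); congr (fine (P _)).
rewrite block_row_eq; apply/seteqP; split=> x /=.
  move=> xz; split; last by have := xz ord_max; rewrite ffunE unlift_none.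
  apply/ffunP => i; rewrite ffunE; have := xz (lift ord_max i).
  by rewrite ffunE liftK lift_max.
move=> [/ffunP xz xw] i; rewrite ffunE; case: unliftP => [j ->|->//].
by rewrite -xz ffunE lift_max.
Qed.

(** Telescoping: adding a block costs the error of [row_law_recr_beta], while the error already made
    is multiplied by [mu w], whose sum over [w] is 1. *)
Lemma row_law_product_law m :
  \sum_(z : {ffun 'I_m -> b.-tuple A}) `|row_law z - product_law z| <=
  (2 * m)%:R * fine (beta P X q).
Proof.
have bt0 : 0 <= fine (beta P X q).
  by rewrite fine_ge0// beta_coef_ge0//; exact: sigma_of_setT.
elim: m => [|m IH].
  rewrite muln0 mul0r big1// => z _.
  have zE y : y = z by apply/ffunP => -[].
  rewrite /product_law big_ord0 /row_law (_ : mkset _ = setT).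
    by rewrite probability_setT subrr normr0.
  by apply/seteqP; split => x //= _.
rewrite sum_ffun_recr.
have -> : (2 * m.+1)%:R * fine (beta P X q) =
    2 * fine (beta P X q) + (2 * m)%:R * fine (beta P X q).
  by rewrite mulnS natrD mulrDl.
apply: le_trans (lerD (row_law_recr_beta m) IH).
rewrite -big_split/=; apply: ler_sum => z _.
rewrite -[X in _ + X]mulr1 -(sum_mu1 hX hstat b) mulr_sumr -big_split/=.
apply: ler_sum => w _.
have -> : product_law [ffun i => if unlift ord_max i is Some j then z j else w]
    = product_law z * mu P X w.
  rewrite /product_law big_ord_recr/= ffunE unlift_none; congr (_ * _).
  apply: eq_bigr => i _; rewrite ffunE.
  rewrite (_ : widen_ord _ i = lift ord_max i) ?liftK//.
  by apply/val_inj/esym; exact: lift_max.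
rewrite -[X in _ + _ * X](@ger0_norm _ (mu P X w)) ?mu_ge0// -normrM.
by apply: le_trans (ler_normD _ _); rewrite mulrBl addrA subrK.
Qed.

Definition typical (m : nat) (z : {ffun 'I_m -> b.-tuple A}) :=
  row_law z <= 2 * product_law z.

Lemma atypical_le s m :
  pr [set x | ~~ typical (block_row s D m b x)] <=
  (2 * m)%:R * fine (beta P X q).
Proof.
rewrite (pr_finpred P (@measurable_block_row _ _ _ _ hX s D m b)
  (fun z => ~~ typical z)).
apply: le_trans (row_law_product_law m).
rewrite [leRHS](_ : _ = \sum_(z : {ffun 'I_m -> b.-tuple A})
    (`|row_law z - product_law z| + (row_law z - product_law z))); last first.
  by rewrite big_split/= [X in _ + X]sumrB sum_row_law sum_product_law subrr addr0.
rewrite big_mkcond/=; apply: ler_sum => z _; rewrite -(row_lawE s).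
have n1 := ler_norm (row_law z - product_law z).
have n2 := ler_norm (- (row_law z - product_law z)).
have := product_law_ge0 z; rewrite normrN in n2.
by case: ifPn; rewrite /typical -?ltNge; lra.
Qed.

(** Change of measure: typical rows satisfy [nu <= 2 nu*] pointwise, which replaces a coupling with
    independent blocks. *)
Lemma typical_event_le s m (E : pred {ffun 'I_m -> b.-tuple A}) :
  pr [set x | E (block_row s D m b x) && typical (block_row s D m b x)] <=
  2 * \sum_(z | E z) product_law z.
Proof.
rewrite (pr_finpred P (@measurable_block_row _ _ _ _ hX s D m b)
  (fun z => E z && typical z)).
rewrite mulr_sumr [leLHS]big_mkcond [leRHS]big_mkcond/=.
apply: ler_sum => z _; case: (E z) => //=; rewrite -(row_lawE s).
by case: ifPn => // _; rewrite mulr_ge0// product_law_ge0.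
Qed.

End decoupling.

(** * Variance of the number of occurrences in a block *)

Section segments.
Context (A : finType) (disp : measure_display) (T : measurableType disp)
  (X : int -> T -> A).

Lemma size_segment s l x : size (segment X s l x) = l.
Proof. exact: size_mkseq. Qed.

Lemma segment_cat s l m x :
  segment X s (l + m) x = segment X s l x ++ segment X (s + l%:Z) m x.
Proof.
rewrite /segment /mkseq iotaD map_cat add0n; congr (_ ++ _).
rewrite -[l in iota l m]addn0 iotaDl -map_comp; apply: eq_map => i /=.
by rewrite PoszD addrA.
Qed.

Lemma segment_window s b c l x : (c + l <= b)%N ->
  take l (drop c (segment X s b x)) = segment X (s + c%:Z) l x.
Proof.
move=> clb; rewrite -(subnK clb) addnC -addnA !segment_cat.
by rewrite drop_size_cat ?size_segment// take_size_cat ?size_segment.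
Qed.

End segments.

Section window_count.
Context (R : realType) (A : finType) (disp : measure_display)
  (T : measurableType disp) (P : probability T R) (X : int -> T -> A)
  (K : (nat -> A) -> A -> R) (lambda : R).
Hypotheses (hX : is_process X) (hstat : stationary P X)
  (hK : transition_kernel K) (hcompat : compatible P X K)
  (hPhi : (Phi P X < +oo)%E) (hlambda1 : lambda < 1)
  (hlambda : forall w a, K w a <= lambda).
Local Notation pr E := (fine (P E)).
Local Notation block := (block X).
Local Notation mu := (mu P X).
Local Notation phi k := (fine (phi P X k)).

Lemma phi_ge0 k : (0 <= Defs.phi P X k)%E.
Proof. by apply: phi_coef_ge0; exact: sigma_of_setT. Qed.

Lemma Phi_fin : Phi P X \is a fin_num.
Proof. by rewrite ge0_fin_numE// nneseries_ge0// => k _ _; exact: phi_ge0. Qed.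

Lemma phi_sum_le_ereal n : (\sum_(0 <= k < n) Defs.phi P X k <= Phi P X)%E.
Proof. by apply: nneseries_lim_ge => k _ _; exact: phi_ge0. Qed.

Lemma phi_fin k : Defs.phi P X k \is a fin_num.
Proof.
rewrite ge0_fin_numE ?phi_ge0//; apply: le_lt_trans hPhi.
apply: le_trans (phi_sum_le_ereal k.+1).
by rewrite big_nat_recr//= leeDr// sume_ge0// => i _; exact: phi_ge0.
Qed.

Lemma phi_sum_le n : \sum_(0 <= k < n) phi k <= fine (Phi P X).
Proof.
rewrite -lee_fin (fineK Phi_fin) -sumEFin; apply: le_trans (phi_sum_le_ereal n).
by rewrite le_eqVlt; apply/orP; left; apply/eqP; apply: eq_bigr => k _; rewrite fineK ?phi_fin.
Qed.

Lemma lambda_ge0 : 0 <= lambda.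
Proof.
(* A point exists because [P] has mass 1; it supplies a past at which to evaluate the kernel. *)
have [x _] : [set: T] !=set0.
  apply/set0P; apply/eqP => T0; have := probability_setT P.
  by rewrite T0 measure0 => /eqP; rewrite eq_sym onee_eq0.
exact: le_trans (kernel_ge0 hK (past X x) (X 0 x)) (hlambda _ _).
Qed.

Lemma measurable_past (B : set (nat -> A)) : past_sigma B ->
  measurable (past X @^-1` B).
Proof.
suff : @past_sigma A `<=` [set C | measurable (past X @^-1` C)] by apply.
apply: smallest_sub.
  split => [|C mC|F mF] /=.
  - by rewrite preimage_set0.
  - by rewrite setTD preimage_setC; exact: measurableC.
  - by rewrite preimage_bigcup; apply: bigcup_measurable => n _; exact: mF.
by move=> _ [j _ [C _ <-]] /=; rewrite setTI; exact: hX.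
Qed.

Lemma kernel_step_le (B : set (nat -> A)) a : past_sigma B ->
  pr (X 0 @^-1` [set a] `&` past X @^-1` B) <= lambda * pr (past X @^-1` B).
Proof.
move=> hB; have mB := measurable_past hB.
rewrite -lee_fin EFinM !prK//; last by apply: measurableI => //; exact: hX.
rewrite hcompat// -(integral_cst P mB); apply: ge0_le_integral => //.
- by move=> x _; rewrite lee_fin; exact: kernel_ge0 hK _ _.
- apply/measurable_EFinP; apply: (measurable_funS measurableT) => //.
  move=> _ U mU; rewrite setTI.
  exact: (measurable_past (kernel_measurable hK a mU)).
- by move=> x _; rewrite lee_fin.
Qed.

(** By stationarity [v] is placed at times [- l] to [-1], so that it becomes an event of the past
    and the added letter is [X 0]. *)
Lemma mu_rcons_le v a : mu (rcons v a) <= lambda * mu v.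
Proof.
set l := size v.
rewrite (mu_segment hstat (- l%:Z)) (mu_segment hstat (- l%:Z) v).
(* Coordinate [j] of a past is time [- (j + 1)], so the letter of index [i] in [v], at time [i - l],
   is coordinate [l - i - 1]. *)
pose B := [set w : nat -> A | forall i : 'I_l,
  ((fun w' => w' (l - i.+1)%N) @^-1` [set tnth (in_tuple v) i]) w].
have hB : past_sigma B.
  apply: sigma_of_forall => i.
  exact: (sigma_of_preimage (f := fun (j : nat) (w : nat -> A) => w j)
    (i := (l - i.+1)%N)).
have BE : [set x | segment X (- l%:Z) l x = v] = past X @^-1` B.
  apply/seteqP; split=> x /= Xv.
    move=> i /=; rewrite (tnth_nth (X 0 x))/=.
    have := congr1 (fun u => nth (X 0 x) u i) Xv; rewrite nth_mkseq// => <-.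
    by rewrite /past; congr (X _ x); have := ltn_ord i; lia.
  apply: (@eq_from_nth _ (X 0 x)); rewrite size_segment// => i il.
  rewrite nth_mkseq//; have := Xv (Ordinal il).
  rewrite /= (tnth_nth (X 0 x))/= => <-.
  by rewrite /past; congr (X _ x); lia.
rewrite BE; apply: le_trans (kernel_step_le a hB).
rewrite le_eqVlt; apply/orP; left; apply/eqP; congr (fine (P _)).
rewrite -BE size_rcons -addn1; apply/seteqP; split=> x /=; rewrite segment_cat.
  rewrite /segment {2}/mkseq/= cats1 => /rcons_inj[-> <-].
  by split=> //=; congr (X _ x); lia.
move=> [Xa ->]; rewrite cats1 -/l; congr rcons; rewrite -Xa.
by congr (X _ x); lia.
Qed.

Lemma mu_cat_le v u : mu (v ++ u) <= lambda ^+ size u * mu v.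
Proof.
elim/last_ind: u => [|u a IH]; first by rewrite cats0 expr0 mul1r.
rewrite -rcons_cat size_rcons exprS -mulrA; apply: le_trans (mu_rcons_le _ _) _.
by rewrite ler_wpM2l// lambda_ge0.
Qed.

Variables (w : seq A).
Hypothesis w_gt0 : (0 < size w)%N.
Local Notation l := (size w).
Local Notation occ s := [set x | segment X s l x = w].

(** Bound, up to the factor [mu w], on the covariance of occurrences starting [h] apart. Disjoint
    ones are separated by [h - l + 1], from the last letter of the first to the first letter of the
    second. *)
Definition corr (h : nat) : R :=
  if (h < l)%N then lambda ^+ h else phi (h - l).+1.

Local Notation s := (fine (Phi P X) + (1 - lambda)^-1).

Lemma corr_ge0 h : 0 <= corr h.
Proof.
rewrite /corr; case: ifP => _; first by rewrite exprn_ge0// lambda_ge0.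
by rewrite fine_ge0// phi_ge0.
Qed.

Lemma fine_Phi_ge0 : 0 <= fine (Phi P X).
Proof. by rewrite fine_ge0// nneseries_ge0// => k _ _; exact: phi_ge0. Qed.

Lemma geometric_sum_le n : \sum_(0 <= h < n) lambda ^+ h <= (1 - lambda)^-1.
Proof.
have l1 : 0 < 1 - lambda by rewrite subr_gt0.
rewrite -[leRHS]mul1r ler_pdivlMr// big_mkord mulrC -opprB mulNr -subrX1.
by rewrite opprB gerBl exprn_ge0// lambda_ge0.
Qed.

(** Lags below [l] form a geometric series; from [l] on they run through [phi 1], [phi 2], and so
    on. *)
Lemma corr_sum_le n : \sum_(0 <= h < n) corr h <= s.
Proof.
have [nl|ln] := leqP n l.
  apply: ler_wpDl; rewrite ?fine_Phi_ge0//; apply: le_trans (geometric_sum_le n).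
  rewrite !big_nat; apply: ler_sum => h /andP[_ hn].
  by rewrite /corr (leq_trans hn nl).
rewrite (big_cat_nat (n := l))//=; last exact: ltnW.
rewrite addrC lerD//; last first.
  apply: le_trans (geometric_sum_le l).
  by rewrite !big_nat; apply: ler_sum => h /andP[_ hl]; rewrite /corr hl.
apply: le_trans (phi_sum_le (n - l).+1).
rewrite big_nat_recl// -[X in \sum_(X <= _ < _) _]add0n big_addn.
rewrite ler_wpDl ?fine_ge0 ?phi_ge0// !big_nat; apply: ler_sum => h _.
by rewrite /corr ltnNge leq_addl/= addnK.
Qed.

(** The two truncated differences add up to the distance of [c] and [c']. Each side of [c]
    contributes at most [s], and lag 0, with [corr 0 = 1] as [w] is nonempty, would be counted
    twice. *)
Lemma corr_dist_sum_le n c : (c < n)%N ->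
  \sum_(c' < n) corr (c - c' + (c' - c)) <= 2 * s - 1.
Proof.
move=> cn; rewrite -(big_mkord predT (fun c' => corr (c - c' + (c' - c)))).
rewrite (big_cat_nat (n := c.+1))//=.
have -> : \sum_(0 <= c' < c.+1) corr (c - c' + (c' - c)) =
    \sum_(0 <= h < c.+1) corr h.
  rewrite big_nat_rev/= !big_nat; apply: eq_bigr => h /andP[_ hc].
  by congr corr; lia.
have -> : \sum_(c.+1 <= c' < n) corr (c - c' + (c' - c)) =
    \sum_(0 <= h < n - c) corr h - 1.
  rewrite [in RHS]big_ltn ?subn_gt0// {2}/corr w_gt0 expr0 addrC addKr.
  rewrite -[X in \sum_(X <= _ < _) _]add1n big_addn !big_nat.
  by apply: eq_bigr => h /andP[h0 _]; congr corr; lia.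
have := corr_sum_le c.+1; have := corr_sum_le (n - c); lra.
Qed.

(** Two occurrences at distance [h <= l] spell out [w] followed by its own last [h] letters. *)
Lemma occ_overlap_le u h : (h <= l)%N ->
  pr (occ u `&` occ (u + h%:Z)) <= lambda ^+ h * mu w.
Proof.
move=> hl; pose v := drop (l - h) w.
have sv : size v = h by rewrite size_drop subKn.
rewrite -[in leRHS]sv; apply: le_trans (mu_cat_le w v).
rewrite (mu_segment hstat u); apply: pr_le.
- by apply: measurableI; exact: measurable_segment.
- exact: measurable_segment.
move=> x /= [Xw Xw']; rewrite size_cat segment_cat Xw; congr (_ ++ _).
have := congr1 (drop (l - h)) Xw'; rewrite -/v sv => <-.
rewrite [X in drop _ (segment _ _ X _)](_ : l = (l - h + h)%N); last by rewrite subnK.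
rewrite segment_cat drop_size_cat ?size_segment//.
by congr (segment _ _ _ _); lia.
Qed.

Lemma occ_cov_le u h :
  pr (occ u `&` occ (u + h%:Z)) <= mu w * corr h + mu w ^+ 2.
Proof.
rewrite /corr; case: ifPn => [hl|]; first apply: le_trans (occ_overlap_le u (ltnW hl)) _.
  by rewrite mulrC lerDl sqr_ge0.
rewrite -leqNgt => lh.
(* The pair is shifted so that the first occurrence ends at time 0, as the definition of phi
   demands. *)
have -> : pr (occ u `&` occ (u + h%:Z)) =
    pr (occ (1 - l%:Z) `&` occ (1 - l%:Z + h%:Z)).
  pose D : pred ((h + l).-tuple A) := fun z =>
    (take l (drop 0 z) == w) && (take l (drop h z) == w).
  have E v : occ v `&` occ (v + h%:Z) = [set x | D (block v (h + l) x)].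
    apply/seteqP; split=> x /=; rewrite /D val_block !segment_window ?leq_addl// addr0.
      by move=> [-> ->]; rewrite eqxx.
    by move=> /andP[/eqP-> /eqP->].
  by rewrite !E -!(sum_mu_pred hX hstat _ D).
(* Phi conditions on events of positive probability only, so a word of mass 0 is treated apart. *)
have [/eqP m0|m0] := eqVneq (mu w) 0.
  rewrite (eqP m0) mul0r expr0n addr0 -(eqP m0) (mu_segment hstat (1 - l%:Z)).
  apply: pr_le; [apply: measurableI| |exact: subIsetl]; exact: measurable_segment.
have mugt : 0 < mu w by rewrite lt_def m0 mu_ge0.
rewrite expr2 -mulrDr [X in _ <= X * _](mu_segment hstat (1 - l%:Z)).
rewrite [X in _ <= _ * (_ + X)](mu_segment hstat (1 - l%:Z + h%:Z)).
have sE (J : set int) v : (forall i : nat, (i < l)%N -> J (v + i%:Z)) ->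
    sigma_of X J (occ v).
  move=> Jv; rewrite (_ : occ v = [set x | block v l x = in_tuple w]).
    exact: sigma_of_block.
  apply/seteqP; split=> x /= Xw; first by apply: val_inj; rewrite /= val_block.
  by rewrite -val_block Xw.
apply: phi_coef_ge.
- by apply: sE => i il /=; lia.
- by apply: sE => i il /=; lia.
- exact: measurable_segment.
- exact: measurable_segment.
- by rewrite -(mu_segment hstat).
- exact: phi_fin.
Qed.

Variables (b B o : nat) (V : pred nat).
Hypothesis fits : (B + o + l <= b.+1)%N.

(** [c] numbers the possible end points in a block. The offset [o] will be [d.+1 - l], so that
    window [c] ends at index [c + d] for every length [l]; [V] selects the end points inside the
    sample. *)
Definition window_count (z : b.-tuple A) : R :=
  \sum_(c < B | V c) (take l (drop (c + o) z) == w)%:R.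

Local Notation N := (#|[pred c : 'I_B | V c]|).

Lemma window_count_ge0 z : 0 <= window_count z.
Proof. exact: sumr_ge0. Qed.

Lemma window_count_le z : window_count z <= N%:R.
Proof.
rewrite /window_count -sum1_card natr_sum; apply: ler_sum => c _.
by case: (_ == _).
Qed.

Lemma window_eq (c : 'I_B) v x :
  (take l (drop (c + o) (block v b x)) == w) =
  (segment X (v + (c + o)%:Z) l x == w).
Proof.
rewrite val_block segment_window//; have := ltn_ord c; move: fits; clear; lia.
Qed.

Lemma window_count_block v x :
  window_count (block v b x) =
  \sum_(c < B | V c) (segment X (v + (c + o)%:Z) l x == w)%:R.
Proof. by apply: eq_bigr => c _; rewrite window_eq. Qed.

Lemma window_mean (c : 'I_B) :
  \sum_(z : b.-tuple A) mu z * (take l (drop (c + o) z) == w)%:R = mu w.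
Proof.
under eq_bigr do rewrite mulr_natr mulrb.
rewrite -big_mkcond/= (sum_mu_pred hX hstat 0
  (fun z : b.-tuple A => take l (drop (c + o) z) == w)).
rewrite (mu_segment hstat (0 + (c + o)%:Z)); congr (fine (P _)).
by apply/seteqP; split=> x /=; rewrite window_eq => /eqP.
Qed.

Lemma window_count_mean : \sum_(z : b.-tuple A) mu z * window_count z = N%:R * mu w.
Proof.
under eq_bigr do rewrite /window_count mulr_sumr.
rewrite exchange_big/=; under eq_bigr do rewrite window_mean.
by rewrite sumr_const mulr_natl.
Qed.

Lemma window_cov (c c' : 'I_B) :
  \sum_(z : b.-tuple A) mu z *
    ((take l (drop (c + o) z) == w)%:R * (take l (drop (c' + o) z) == w)%:R) <=
  mu w * corr (c - c' + (c' - c)) + mu w ^+ 2.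
Proof.
wlog cc : c c' / (c <= c')%N => [H|].
  have [/H//|/ltnW/H] := leqP c c'.
  by rewrite [(c - c' + _)%N]addnC; under [in X in _ -> X]eq_bigr do rewrite [X in _ * X]mulrC.
have -> : (c - c' + (c' - c) = c' - c)%N by lia.
apply: le_trans (occ_cov_le (c + o)%:Z (c' - c)).
under eq_bigr do rewrite -natrM mulnb mulr_natr mulrb.
rewrite -big_mkcond/= (sum_mu_pred hX hstat 0 (fun z : b.-tuple A =>
  (take l (drop (c + o) z) == w) && (take l (drop (c' + o) z) == w))).
rewrite le_eqVlt; apply/orP; left; apply/eqP; congr (fine (P _)).
have E : (0 + (c' + o)%:Z)%R = (c + o)%:Z + (c' - c)%:Z by lia.
apply/seteqP; split=> x /=; rewrite !window_eq E add0r.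
  by move=> /andP[/eqP-> /eqP->].
by move=> [-> ->]; rewrite eqxx.
Qed.

(** The square is expanded into covariances; each of the [N] rows of the double sum is at most
    [mu w * (2 * s - 1)]. *)
Lemma window_count_var :
  \sum_(z : b.-tuple A) mu z * (window_count z - N%:R * mu w) ^+ 2 <=
  N%:R * mu w * s ^+ 2.
Proof.
set m := N%:R * mu w.
have -> : \sum_(z : b.-tuple A) mu z * (window_count z - m) ^+ 2 =
    \sum_(z : b.-tuple A) mu z * window_count z ^+ 2 - m ^+ 2.
  have -> : - m ^+ 2 = \sum_(z : b.-tuple A) (m ^+ 2 * mu z
      - 2 * m * (mu z * window_count z)).
    by rewrite sumrB -!mulr_sumr window_count_mean (sum_mu1 hX hstat) -/m; ring.
  by rewrite -big_split/=; apply: eq_bigr => z _; ring.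
have -> : m ^+ 2 = \sum_(c < B | V c) \sum_(c' < B | V c') mu w ^+ 2.
  by rewrite !sumr_const -mulrnA -[RHS]mulr_natl natrM /m; ring.
have -> : \sum_(z : b.-tuple A) mu z * window_count z ^+ 2 =
   \sum_(c < B | V c) \sum_(c' < B | V c') \sum_(z : b.-tuple A) mu z *
    ((take l (drop (c + o) z) == w)%:R * (take l (drop (c' + o) z) == w)%:R).
  under [RHS]eq_bigr do rewrite exchange_big/=.
  rewrite [RHS]exchange_big/=; apply: eq_bigr => z _.
  rewrite expr2 /window_count big_distrlr/= mulr_sumr.
  by apply: eq_bigr => c _; rewrite mulr_sumr.
rewrite -sumrB; apply: (@le_trans _ _ (\sum_(c < B | V c) mu w * s ^+ 2)).
  apply: ler_sum => c _; rewrite -sumrB.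
  apply: (@le_trans _ _ (\sum_(c' < B) mu w * corr (c - c' + (c' - c)))).
    rewrite big_mkcond/=; apply: ler_sum => c' _; case: ifP => _.
      by rewrite lerBlDr window_cov.
    by rewrite mulr_ge0 ?mu_ge0 ?corr_ge0.
  rewrite -mulr_sumr ler_wpM2l ?mu_ge0//.
  apply: le_trans (corr_dist_sum_le (ltn_ord c)) _.
  (* [2 * s - 1 <= s ^+ 2]: a square makes the standard deviation linear in [s], the form of
     [L_star]. *)
  by rewrite -subr_ge0 (_ : _ - _ = (s - 1) ^+ 2) ?sqr_ge0//; ring.
by rewrite sumr_const -mulrA mulr_natl.
Qed.

End window_count.

(** * Deviation of the empirical measure *)

Lemma sum_two_blocks (V : nmodType) (G : nat -> V) (B m : nat) :
  \sum_(0 <= k < m * (2 * B)) G k =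
  \sum_(i < m) (\sum_(c < B) G (2 * B * i + c)%N +
                \sum_(c < B) G (2 * B * i + B + c)%N).
Proof.
elim: m => [|m IH]; first by rewrite mul0n big_geq// big_ord0.
rewrite big_ord_recr/= -IH mulSn (big_cat_nat (n := (m * (2 * B))%N))//=; last first.
  exact: leq_addl.
congr (_ + _); rewrite -[X in \sum_(X <= _ < _) _]add0n big_addn addnK mul2n -addnn.
rewrite (big_cat_nat (n := B))//= ?leq_addr// -[X in _ + \sum_(X <= _ < _) _]add0n.
rewrite big_addn addnK !big_mkord; congr (_ + _); apply: eq_bigr => c _; congr G; lia.
Qed.

(** End points are written [k = j.+1] with [j] running over [m] pairs of adjacent blocks; the guards
    restore the range [l <= k <= t]. *)
Lemma sum_range_blocks (V : nmodType) (F : nat -> V) (B m l t : nat) :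
  (0 < l)%N -> (t <= m * (2 * B))%N ->
  \sum_(l <= k < t.+1) F k =
  \sum_(i < m) \sum_(c < B | (l <= (2 * B * i + c).+1 <= t)%N) F (2 * B * i + c).+1%N +
  \sum_(i < m) \sum_(c < B | (l <= (2 * B * i + B + c).+1 <= t)%N)
    F (2 * B * i + B + c).+1%N.
Proof.
case: l => // l _ tm; rewrite big_add1/=.
rewrite (big_nat_widenl _ 0)// (big_nat_widen _ _ (m * (2 * B)))// big_mkcond/=.
rewrite sum_two_blocks big_split/=.
by congr (_ + _); apply: eq_bigr => i _; rewrite [RHS]big_mkcond.
Qed.

(** [Ne] and [No] count the end points in even and odd blocks; their sum may be [N - 1] since [t]
    may be [n - 1]. In units of [s * N * r], the two square roots cost [5 / 2] and the missing end
    point [3 / 2], hence the constant 4. The two linear terms add up to [B * y]. *)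
Lemma deviation_arith (R : realType) (Ne No N mu y s B d Se So : R) :
  0 <= Ne -> 0 <= No -> 1 <= N -> N - 1 <= Ne + No -> Ne + No <= N ->
  0 <= mu -> mu <= 1 -> 3 / 4 <= y -> 1 <= s -> 0 <= d ->
  `|Se - Ne * mu| <= Num.sqrt (2 * (Ne * mu * s ^+ 2) * (3 / 2 * y)) +
     B * (3 / 2 * y) / 3 ->
  `|So - No * mu| <= Num.sqrt (2 * (No * mu * s ^+ 2) * (3 / 2 * y)) +
     B * (3 / 2 * y) / 3 ->
  `|N^-1 * (Se + So) - mu| <=
    4 * s * Num.sqrt (mu * y / N) + (d + B) * y / N.
Proof.
move=> Ne0 No0 N1 NN1 NN mu0 mu1 y34 s1 d0.
have y0 : 0 <= y by lra.
have N0 : 0 < N by lra.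
have s0 : 0 <= s by lra.
set p : R := Num.sqrt (2 * (Ne * _ * _) * _).
set q : R := Num.sqrt (2 * (No * _ * _) * _).
set r : R := Num.sqrt (mu * y / N) => He Ho.
have r0 : 0 <= r by exact: sqrtr_ge0.
have r2 : r ^+ 2 * N = mu * y.
  by rewrite sqr_sqrtr ?divfK ?gt_eqF// divr_ge0 ?mulr_ge0// ltW.
(* [(p + q) ^+ 2] is at most twice the sum of the squares, which gives the factor
   [sqrt 6 <= 5 / 2]. *)
have pq : p + q <= 5 / 2 * s * N * r.
  rewrite -ler_sqr ?nnegrE ?addr_ge0 ?sqrtr_ge0 ?mulr_ge0//; try lra.
  have p2 : p ^+ 2 = 3 * (Ne * (mu * y * s ^+ 2)).
    by rewrite sqr_sqrtr; [field|rewrite !mulr_ge0 ?sqr_ge0//; lra].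
  have q2 : q ^+ 2 = 3 * (No * (mu * y * s ^+ 2)).
    by rewrite sqr_sqrtr; [field|rewrite !mulr_ge0 ?sqr_ge0//; lra].
  have k0 : 0 <= mu * y * s ^+ 2 by rewrite !mulr_ge0 ?sqr_ge0.
  have -> : (5 / 2 * s * N * r) ^+ 2 = 25 / 4 * (N * (mu * y * s ^+ 2)).
    by rewrite -r2; field.
  have : (Ne + No) * (mu * y * s ^+ 2) <= N * (mu * y * s ^+ 2) by rewrite ler_wpM2r.
  have : 0 <= N * (mu * y * s ^+ 2) by rewrite mulr_ge0// ltW.
  have := sqr_ge0 (p - q); rewrite sqrrB sqrrD p2 q2; lra.
have mur : mu <= 3 / 2 * N * r.
  rewrite -ler_sqr ?nnegrE ?mulr_ge0//; try lra.
  have -> : (3 / 2 * N * r) ^+ 2 = 9 / 4 * (N * (mu * y)) by rewrite -r2; field.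
  have : mu * mu <= mu * 1 by rewrite ler_wpM2l.
  have : mu * (3 / 4) <= mu * y by rewrite ler_wpM2l.
  have : 1 * (mu * y) <= N * (mu * y) by rewrite ler_wpM2r// mulr_ge0.
  rewrite expr2; lra.
have sr : N * r <= s * N * r by rewrite -mulrA ler_peMl// mulr_ge0// ltW.
rewrite -(ler_pM2l N0) -{1}(gtr0_norm N0) -normrM mulrBr mulVKf ?gt_eqF//.
have -> : N * (4 * s * r + (d + B) * y / N) = 4 * (s * N * r) + d * y + B * y.
  by field; rewrite gt_eqF.
have dy : 0 <= d * y by rewrite mulr_ge0.
have mN : (N - (Ne + No)) * mu <= 1 * mu by rewrite ler_wpM2r//; lra.
have mN0 : 0 <= (N - (Ne + No)) * mu by rewrite mulr_ge0//; lra.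
have -> : Se + So - N * mu = (Se - Ne * mu) + (So - No * mu) - (N - (Ne + No)) * mu.
  by ring.
apply: le_trans (ler_normB _ _) _; rewrite (ger0_norm mN0).
have := ler_normD (Se - Ne * mu) (So - No * mu); lra.
Qed.

(** [expR (- (3 / 2 * y))] is [expR (- y)] times [expR (- y / 2)], and the latter is at most
    [1 / 2]. *)
Lemma expR_threshold (R : realType) (y : R) : expR (- y) <= 1 / 4 ->
  3 / 4 <= y /\ 8 * expR (- (3 / 2 * y)) <= 4 * expR (- y).
Proof.
move=> y4; split; first by have := expR_ge1Dx (- y); lra.
have -> : - (3 / 2 * y) = - y + - y / 2 by field.
have e2 : expR (- y / 2) ^+ 2 = expR (- y) by rewrite -expRM_natr; congr expR; field.
have e0 := expR_gt0 (- y / 2); have e1 := expR_gt0 (- y).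
have : expR (- y / 2) <= 1 / 2.
  rewrite -ler_sqr ?nnegrE; [|exact: ltW|by []].
  by rewrite e2 (_ : (1 / 2) ^+ 2 = 1 / 4); [|field].
rewrite expRD => h; have : expR (- y) * expR (- y / 2) <= expR (- y) * (1 / 2).
  by rewrite ler_pM2l.
lra.
Qed.

Section empirical_measure.
Context (R : realType) (A : finType) (disp : measure_display)
  (T : measurableType disp) (P : probability T R) (X : int -> T -> A)
  (K : (nat -> A) -> A -> R) (lambda : R).
Hypotheses (hX : is_process X) (hstat : stationary P X)
  (hK : transition_kernel K) (hcompat : compatible P X K)
  (hPhi : (Phi P X < +oo)%E) (hlambda1 : lambda < 1)
  (hlambda : forall w a, K w a <= lambda).
Local Notation pr E := (fine (P E)).
Local Notation block := (block X).
Local Notation block_row := (block_row X).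
Local Notation mu := (mu P X).
Local Notation s := (fine (Phi P X) + (1 - lambda)^-1).

Lemma constant_ge1 : 1 <= s.
Proof.
have l0 : 0 <= lambda by exact: (lambda_ge0 P X hK).
apply: ler_wpDl; first exact: fine_Phi_ge0.
by rewrite -[leLHS]invr1 lef_pV2 ?posrE ?subr_gt0 ?gerBl.
Qed.

(** The estimator is a function of the single finite-valued block of the letters at times 1 to
    [t]. *)
Lemma measurable_mu_hat n t (w : seq A) (D : pred R) :
  measurable [set x | D (mu_hat R X n t w x)].
Proof.
pose G (z : t.-tuple A) : R := (n%:R - (size w)%:R + 1)^-1 *
  \sum_(size w <= k < t.+1) (take (size w) (drop (k - size w) z) == w)%:R.
rewrite (_ : mkset _ = [set x | D (G (block 1 t x))]).
  exact: (measurable_finpred (measurable_block hX 1 (b := t)) (D \o G)).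
have GE x : mu_hat R X n t w x = G (block 1 t x).
  rewrite /mu_hat /G !big_nat; congr (_ * _); apply: eq_bigr => k /andP[wk kt].
  rewrite val_block segment_window; last by move: wk kt; clear; lia.
  by congr ((segment _ _ _ _ == _)%:R); move: wk; clear; lia.
by apply/seteqP; split=> x /=; rewrite GE.
Qed.

Section one_parity.
Variables (w : seq A) (B b o m D : nat) (V : 'I_m -> pred nat) (u : int).
Hypotheses (w_gt0 : (0 < size w)%N) (B_gt0 : (0 < B)%N)
  (fits : (B + o + size w <= b.+1)%N).
Local Notation N i := (#|[pred c : 'I_B | V i c]|).
Local Notation Ntot := (\sum_(i < m) N i)%N.
Local Notation count := (fun (z : {ffun 'I_m -> b.-tuple A}) =>
  \sum_(i < m) window_count R w B o (V i) (z i)).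
Local Notation threshold x :=
  (Num.sqrt (2 * (Ntot%:R * mu w * s ^+ 2) * x) + B%:R * x / 3).

(** The sign [(-1) ^+ e] selects the tail. For either sign a centred count is at most [B], since the
    count and its mean both lie between 0 and [N i <= B]. *)
Lemma product_deviation_le (e : bool) (x : R) : 0 < x ->
  \sum_(z : {ffun 'I_m -> b.-tuple A} |
     threshold x < (-1) ^+ e * (count z - Ntot%:R * mu w))
     product_law P X z <= expR (- x).
Proof.
move=> x0.
pose h i (z : b.-tuple A) : R :=
  (-1) ^+ e * (window_count R w B o (V i) z - (N i)%:R * mu w).
have NB i : (N i)%:R <= B%:R :> R by rewrite ler_nat (leq_trans (max_card _)) ?card_ord.
have muN i : (N i)%:R * mu w <= (N i)%:R by rewrite ler_piMr ?mu_le1.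
have muN0 i : 0 <= (N i)%:R * mu w by rewrite mulr_ge0 ?mu_ge0.
have h_le i z : h i z <= B%:R.
  have c0 := window_count_ge0 R w B o (V i) z.
  have cN := window_count_le R w B o (V i) z.
  have := NB i; have := muN i; have := muN0 i.
  by rewrite /h; case: (e); rewrite ?expr1 ?expr0; lra.
have h_mean i : \sum_(z : b.-tuple A) mu z * h i z = 0.
  under eq_bigr do rewrite mulrCA mulrBr.
  rewrite -mulr_sumr sumrB window_count_mean// -mulr_suml (sum_mu1 hX hstat).
  by rewrite mul1r subrr mulr0.
have h_var i : \sum_(z : b.-tuple A) mu z * h i z ^+ 2 <= (N i)%:R * mu w * s ^+ 2.
  under eq_bigr do rewrite exprMn sqrr_sign mul1r.
  exact: (window_count_var hX hstat hK hcompat).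
have B0 : 0 < B%:R :> R by rewrite ltr0n.
have vE : \sum_(i < m) (N i)%:R * mu w * s ^+ 2 <= Ntot%:R * mu w * s ^+ 2.
  by rewrite -!mulr_suml -natr_sum.
have p0 (z : b.-tuple A) : 0 <= mu z by exact: mu_ge0.
apply: le_trans (bernstein p0 (sum_mu1 hX hstat b) B0 h_le h_mean h_var vE x0).
rewrite le_eqVlt; apply/orP; left; apply/eqP; apply: eq_bigl => z.
by rewrite /h -mulr_sumr sumrB -mulr_suml -natr_sum.
Qed.

(** One factor 2 comes from the change of measure, the other from the two tails. *)
Lemma parity_deviation_le (x : R) : 0 < x ->
  pr [set v | (threshold x < `|count (block_row u D m b v) - Ntot%:R * mu w|)
     && typical P X D (block_row u D m b v)] <= 4 * expR (- x).
Proof.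
move=> x0.
apply: le_trans (typical_event_le hX hstat D u (fun z =>
  threshold x < `|count z - Ntot%:R * mu w|)) _.
rewrite (_ : 4 * _ = 2 * (expR (- x) + expR (- x))); last by ring.
rewrite ler_pM2l//.
have Hp := product_deviation_le false x0; have Hn := product_deviation_le true x0.
apply: le_trans (lerD Hp Hn).
rewrite big_mkcond [X in _ <= X + _]big_mkcond [X in _ <= _ + X]big_mkcond/=.
rewrite -big_split/=; apply: ler_sum => z _; rewrite expr0 expr1 mul1r mulN1r.
have p0 := product_law_ge0 P X z; rewrite ltr_normr.
by case: (_ < _); case: (_ < _) => /=; lra.
Qed.

End one_parity.

End empirical_measure.

(** * Assembly of the even and odd blocks *)

Section concentration.
Context (R : realType) (A : finType) (disp : measure_display)
  (T : measurableType disp) (P : probability T R) (X : int -> T -> A)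
  (K : (nat -> A) -> A -> R) (lambda : R).
Hypotheses (hX : is_process X) (hstat : stationary P X)
  (hK : transition_kernel K) (hcompat : compatible P X K)
  (hPhi : (Phi P X < +oo)%E) (hlambda1 : lambda < 1)
  (hlambda : forall w a, K w a <= lambda).
Local Notation pr E := (fine (P E)).
Local Notation block_row := (block_row X).
Local Notation mu := (mu P X).

Lemma pr_setU_le E F : measurable E -> measurable F ->
  pr (E `|` F) <= pr E + pr F.
Proof.
move=> mE mF; rewrite -lee_fin EFinD !prK//; last exact: measurableU.
exact: measureU2.
Qed.

Definition deviation_event (n d q t : nat) (y : R) (w : seq A) : set T :=
  [set x | (`|mu_hat R X n t w x - mu w| >
     L_star P X lambda * Num.sqrt (mu w * y / (n%:R - (size w)%:R + 1)) +
     (d + (d + q))%:R * y / (n%:R - (size w)%:R + 1))%R].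

Lemma measurable_deviation_event n d q t y w :
  measurable (deviation_event n d q t y w).
Proof.
exact: (measurable_mu_hat hX n t w (fun v : R => `|v - mu w| >
  L_star P X lambda * Num.sqrt (mu w * y / (n%:R - (size w)%:R + 1)) +
  (d + (d + q))%:R * y / (n%:R - (size w)%:R + 1))).
Qed.

Section block_case.
Variables (n d q t : nat).
Hypotheses (n_gt1 : (1 < n)%N) (dn : (d < n)%N) (tn : (n.-1 <= t <= n)%N)
  (dq_gt0 : (0 < d + q)%N) (beta_fin : beta P X q \is a fin_num).
Local Notation B := (d + q)%N.
Local Notation D := (2 * B)%N.
(** A block holds [B] end points and the [d] letters before them, which an occurrence of length at
    most [d.+1] can reach. The start [1 - d] makes time 1 the first end point, and [q] letters
    separate consecutive blocks of one parity. *)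
Local Notation b := (B + d)%N.
Local Notation even_row := (block_row (1 - d%:Z) D n b).
Local Notation odd_row := (block_row (1 - d%:Z + B%:Z) D n b).

Lemma measurable_typical u :
  measurable [set x | typical P X D (block_row u D n b x)].
Proof. exact: (measurable_finpred (@measurable_block_row _ _ _ _ hX u D n b)). Qed.

Section one_word.
Variable w : seq A.
Hypotheses (w_gt0 : (0 < size w)%N) (wd : (size w <= d.+1)%N).
Local Notation l := (size w).
Local Notation o := (d.+1 - l)%N.

Definition even_valid (i : 'I_n) : pred nat :=
  fun c => (l <= (D * i + c).+1 <= t)%N.
Definition odd_valid (i : 'I_n) : pred nat :=
  fun c => (l <= (D * i + B + c).+1 <= t)%N.

Local Notation count V z := (\sum_(i < n) window_count R w B o (V i) (z i)).
Local Notation total V := (\sum_(i < n) #|[pred c : 'I_B | V i c]|)%N.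

Lemma window_fits : (B + o + l <= b.+1)%N.
Proof. by move: wd; clear; lia. Qed.

Lemma covered : (t <= n * D)%N.
Proof.
have /andP[_ tn2] := tn; apply: leq_trans tn2 _.
by rewrite -[leqLHS]muln1 leq_mul2l muln_gt0 dq_gt0 orbT.
Qed.

(** Each occurrence is charged to the block of its last letter: window [c] of the even block [i]
    ends at time [D * i + c + 1]. *)
Lemma occurrence_count x :
  \sum_(l <= k < t.+1) (segment X (k%:Z - l%:Z + 1) l x == w)%:R =
  count even_valid (even_row x) + count odd_valid (odd_row x) :> R.
Proof.
rewrite (sum_range_blocks _ w_gt0 covered); congr (_ + _).
  apply: eq_bigr => i _; rewrite ffunE window_count_block ?window_fits//.
  apply: eq_bigr => c _; congr ((segment _ _ _ _ == _)%:R).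
  by move: wd; clear; lia.
apply: eq_bigr => i _; rewrite ffunE window_count_block ?window_fits//.
apply: eq_bigr => c _; congr ((segment _ _ _ _ == _)%:R).
by move: wd; clear; lia.
Qed.

Lemma total_count : (total even_valid)%:R + (total odd_valid)%:R =
  (t.+1 - l)%:R :> R.
Proof.
rewrite -[RHS](sumr_const_nat t.+1 l (1 : R)) (sum_range_blocks _ w_gt0 covered).
rewrite !natr_sum; congr (_ + _); apply: eq_bigr => i _.
  by rewrite -sum1_card natr_sum.
by rewrite -sum1_card natr_sum.
Qed.

Lemma deviation_event_typical y : 0 < y -> expR (- y) <= 1 / 4 ->
  pr (deviation_event n d q t y w `&`
    ([set x | typical P X D (even_row x)] `&`
     [set x | typical P X D (odd_row x)])) <= 4 * expR (- y).
Proof.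
move=> y0 /expR_threshold[y34 y8].
set s := fine (Phi P X) + (1 - lambda)^-1.
set x0 := 3 / 2 * y; have x0_gt0 : 0 < x0 by rewrite mulr_gt0.
pose thr N : R := Num.sqrt (2 * (N%:R * mu w * s ^+ 2) * x0) + B%:R * x0 / 3.
pose bad (V : 'I_n -> pred nat) (z : {ffun 'I_n -> b.-tuple A}) :=
  thr (total V) < `|count V z - (total V)%:R * mu w|.
pose F V u := [set x | bad V (block_row u D n b x) &&
  typical P X D (block_row u D n b x)].
have mF V u : measurable (F V u).
  exact: (measurable_finpred (@measurable_block_row _ _ _ _ hX u D n b)
    (fun z => bad V z && typical P X D z)).
have FE V u : pr (F V u) <= 4 * expR (- x0).
  exact: (parity_deviation_le hX hstat hK hcompat hPhi hlambda1 hlambda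
    D V u w_gt0 dq_gt0 window_fits).
apply: le_trans y8; have -> : 8 * expR (- (3 / 2 * y)) =
  4 * expR (- x0) + 4 * expR (- x0) by rewrite /x0; ring.
apply: le_trans (lerD (FE even_valid (1 - d%:Z)) (FE odd_valid (1 - d%:Z + B%:Z))).
apply: le_trans (pr_setU_le (mF _ _) (mF _ _)).
apply: pr_le; [|exact: measurableU|].
  apply: measurableI; first exact: measurable_deviation_event.
  by apply: measurableI; exact: measurable_typical.
(* By contraposition: on typical rows, if neither parity deviates, the estimator does not deviate
   either. *)
move=> x /= [dev [te to]]; apply: contraPP dev; rewrite /F/= te to !andbT => nF.
have /negP := fun h => nF (or_introl h); have /negP := fun h => nF (or_intror h).
rewrite /bad -!leNgt => ho he; apply/negP; rewrite -leNgt natrD.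
have /andP[tn1 tn2] := tn.
(* The truncated subtraction is exact, as [l <= d + 1 <= n <= t + 1]. *)
have Nlt : ((t.+1 - l)%:R = t%:R - l%:R + 1 :> R).
  by rewrite natrB ?natr1 -?natr1; [ring|move: wd dn tn1; clear; lia].
have tR : (t%:R <= n%:R :> R) by rewrite ler_nat.
have nR : (n%:R - 1 <= t%:R :> R).
  by rewrite lerBlDr natr1 ler_nat; move: tn1; clear; lia.
have ln : (l%:R <= n%:R :> R) by rewrite ler_nat; move: wd dn; clear; lia.
rewrite /mu_hat occurrence_count /L_star -/s.
apply: (deviation_arith (s := s) (Ne := (total even_valid)%:R)
  (No := (total odd_valid)%:R)) => //.
- by lra.
- by rewrite total_count Nlt; lra.
- by rewrite total_count Nlt; lra.
- exact: mu_ge0.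
- exact: mu_le1.
- exact: (constant_ge1 P X hK).
Qed.

End one_word.

Lemma block_coupling :
  exists Omega : set T,
    [/\ measurable Omega,
        (P (~` Omega) <= (2 * n%:R ^+ 2)%R%:E * beta P X q)%E &
        forall (y : R) (w : seq A), 0 < y -> (0 < size w <= d.+1)%N ->
          (P (deviation_event n d q t y w `&` Omega) <=
            (4 * expR (- y))%:E)%E].
Proof.
pose Oe := [set x | typical P X D (even_row x)].
pose Oo := [set x | typical P X D (odd_row x)].
have mOe : measurable Oe by exact: measurable_typical.
have mOo : measurable Oo by exact: measurable_typical.
have bt0 : 0 <= fine (beta P X q).
  by rewrite fine_ge0// beta_coef_ge0//; exact: sigma_of_setT.
have gap : (b + q <= D.+1)%N by clear; lia.
have atyp u : pr (~` [set x | typical P X D (block_row u D n b x)]) <=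
    (2 * n)%:R * fine (beta P X q).
  rewrite (_ : ~` _ = [set x | ~~ typical P X D (block_row u D n b x)]).
    exact: atypical_le.
  by apply/seteqP; split=> x /=; [move/negP|move=> /negP].
exists (Oe `&` Oo); split.
- exact: measurableI.
- rewrite setCI -(fineK beta_fin) -prK; last first.
    by apply: measurableU; exact: measurableC.
  rewrite -EFinM lee_fin; apply: le_trans (pr_setU_le _ _) _; try exact: measurableC.
  apply: le_trans (lerD (atyp _) (atyp _)) _; rewrite -mulrDl ler_wpM2r//.
  (* Both parities together cost [4 * n] times beta, at most [2 * n ^+ 2] times beta once
     [n >= 2]. *)
  have n2 : (2 : R) <= n%:R by rewrite ler_nat.
  have : 2 * n%:R <= n%:R * n%:R :> R by rewrite ler_wpM2r.
  by rewrite natrM expr2; lra.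
move=> y w y0 /andP[w_gt0 wd].
have mE : measurable (deviation_event n d q t y w `&` (Oe `&` Oo)).
  by apply: measurableI; [exact: measurable_deviation_event|exact: measurableI].
(* If [expR (- y)] exceeds [1 / 4], the bound exceeds 1. *)
rewrite -prK// lee_fin; have [y4|y4] := leP (expR (- y)) (1 / 4).
  exact: deviation_event_typical.
by apply: le_trans (pr_le1 P mE) _; lra.
Qed.

End block_case.

(** * Degenerate case [d = q = 0] *)

Lemma pr_setC E : measurable E -> pr (~` E) = 1 - pr E.
Proof.
move=> mE; apply: EFin_inj; rewrite prK ?EFinB ?prK ?probability_setC//.
exact: measurableC.
Qed.

Lemma pr_setI_ge E F : measurable E -> measurable F ->
  pr E + pr F - 1 <= pr (E `&` F).
Proof.
move=> mE mF; have := pr_setU_le (measurableC mE) (measurableC mF).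
rewrite -setCI !pr_setC//; last exact: measurableI.
lra.
Qed.

Lemma mu_letter a : mu [:: a] = pr [set x | X 0 x = a].
Proof.
rewrite (mu_segment hstat 0); congr (fine (P _)).
by apply/seteqP; split=> x /=; rewrite /segment /mkseq/= addr0;
  [case|move=> ->].
Qed.

Lemma measurable_letter a : measurable [set x | X 0 x = a].
Proof. exact: (hX 0 [set a]). Qed.

Lemma sum_mu_letter : \sum_a mu [:: a] = 1.
Proof.
rewrite -(pr_fin_sum1 P measurable_letter).
by apply: eq_bigr => a _; rewrite mu_letter.
Qed.

(* The partition into the values of [X 0] is measurable for both the past and
   the future at gap [0]. *)
Lemma beta0_ge c : (forall a, mu [:: a] <= mu [:: c]) ->
  ((1 - mu [:: c])%:E <= beta P X 0)%E.
Proof.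
move=> c_max; have X0 (J : set int) a : J 0 -> sigma_of X J [set x | X 0 x = a].
  by move=> J0; exact: (sigma_of_preimage (f := X) [set a] J0).
apply: le_trans (beta_coef_ge_fin P (fun a => X0 _ a _) (fun a => X0 _ a _)) => //.
rewrite lee_fin -ler_pdivrMl ?invr_gt0// invrK.
have -> : 2 * (1 - mu [:: c]) =
    \sum_a 2 * (mu [:: a] * (1 - mu [:: c])).
  by rewrite -mulr_sumr -mulr_suml sum_mu_letter mul1r.
(* The row of [a] contributes [mu a * (1 - mu a)] on the diagonal and the same amount off it; [c]
   maximises [mu]. *)
apply: ler_sum => a _; rewrite (bigD1 a)//= setIid -!mu_letter.
under eq_bigr => v va.
  rewrite (_ : _ `&` _ = set0); last first.
    by apply/seteqP; split=> // x [/= -> av]; rewrite av eqxx in va.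
  rewrite measure0/= sub0r normrN ger0_norm ?mulr_ge0 ?pr_ge0//.
  by rewrite -!mu_letter; over.
rewrite -mulr_sumr; have := sum_mu_letter; rewrite (bigD1 a)//= => sum1.
have -> : \sum_(v | v != a) mu [:: v] = 1 - mu [:: a] by rewrite -sum1 addrAC subrr add0r.
have a0 : 0 <= mu [:: a] := mu_ge0 _ _ _.
have a1 : mu [:: a] <= 1 := mu_le1 _ hX _.
have -> : mu [:: a] - mu [:: a] * mu [:: a] = mu [:: a] * (1 - mu [:: a]) by ring.
rewrite ger0_norm ?mulr_ge0 ?subr_ge0//.
have : mu [:: a] * (1 - mu [:: c]) <= mu [:: a] * (1 - mu [:: a]).
  by rewrite ler_wpM2l// lerB.
lra.
Qed.

(** Union bound: each of the [n] letters differs from [a] with probability [1 - mu [:: a]]. *)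
Lemma mu_nseq_ge n a : 1 - n%:R * (1 - mu [:: a]) <= mu (nseq n a).
Proof.
elim: n => [|n IH].
  rewrite mul0r subr0 /mu (_ : mkset _ = setT) ?probability_setT//.
  by apply/seteqP; split.
have mS u l (w : seq A) := measurable_segment hX u l w.
have := pr_setI_ge (mS 0 1%N [:: a]) (mS 1 n (nseq n a)).
have -> : pr [set x | segment X 0 1 x = [:: a]] = mu [:: a].
  by rewrite -(mu_segment hstat 0 [:: a]).
have -> : pr [set x | segment X 1 n x = nseq n a] = mu (nseq n a).
  by rewrite (mu_segment hstat 1) size_nseq.
have -> : [set x | segment X 0 1 x = [:: a]] `&`
    [set x | segment X 1 n x = nseq n a] =
    [set x | segment X 0 (size (nseq n.+1 a)) x = nseq n.+1 a].
  have E x : (segment X 0 (size (nseq n.+1 a)) x == nseq n.+1 a) =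
      (segment X 0 1 x == [:: a]) && (segment X 1 n x == nseq n a).
    rewrite size_nseq -add1n segment_cat add0r -[nseq _ _]/([:: a] ++ nseq n a).
    by rewrite eqseq_cat ?size_segment.
  apply/seteqP; split=> x; first by move=> [/eqP h1 /eqP hn]; apply/eqP; rewrite E h1 hn.
  by move=> /eqP; rewrite E => /andP[/eqP h1 /eqP hn].
rewrite -(mu_segment hstat) -natr1; lra.
Qed.

Lemma mu_hat_constant n t a c x : (t <= n)%N -> segment X 1 n x = nseq n c ->
  mu_hat R X n t [:: a] x = n%:R^-1 * (t * (c == a))%:R.
Proof.
move=> tn Xc; rewrite /mu_hat/= subrK; congr (_ * _).
have E k : (0 < k < t.+1)%N -> (segment X (k%:Z - 1 + 1) 1 x == [:: a]) = (c == a).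
  move=> /andP[k0 kt]; rewrite /segment /mkseq/= addr0 subrK.
  have := congr1 (fun u => nth c u k.-1) Xc; rewrite nth_nseq if_same.
  rewrite nth_mkseq; last by move: k0 kt tn; clear; lia.
  rewrite (_ : 1 + k.-1%:Z = k%:Z); last by move: k0; clear; lia.
  by move=> ->; rewrite eqseq_cons andbT.
rewrite big_nat; under eq_bigr => k kt do rewrite E//.
by rewrite -big_nat sumr_const_nat subn1/= -mulrnA mulnC.
Qed.

(* With [d = q = 0] the deviation bound has no linear term.  Unless [Omega] may
   be empty, some letter [c] has mass so close to [1] that [Omega] can be the
   event that [X] equals [c] throughout the sample. *)
Lemma constant_coupling (n t : nat) :
  (0 < n)%N -> (n.-1 <= t <= n)%N -> beta P X 0 \is a fin_num ->
  2 * n%:R ^+ 2 * fine (beta P X 0) < 1 ->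
  exists Omega : set T,
    [/\ measurable Omega,
        (P (~` Omega) <= (2 * n%:R ^+ 2)%R%:E * beta P X 0)%E &
        forall (y : R) (w : seq A), 0 < y -> (0 < size w <= 1)%N ->
          (P (deviation_event n 0 0 t y w `&` Omega) <=
            (4 * expR (- y))%:E)%E].
Proof.
move=> n0 /andP[tn1 tn] bfin small.
have [x0 _] : [set: T] !=set0.
  apply/set0P; apply/eqP => T0; have := probability_setT P.
  by rewrite T0 measure0 => /eqP; rewrite eq_sym onee_eq0.
have [c c_max] : exists c, forall a, mu [:: a] <= mu [:: c].
  exists [arg max_(c > X 0 x0) mu [:: c]]%O => a.
  by case: arg_maxP => // c _ /(_ a); exact.
have := beta0_ge c_max; rewrite -(fineK bfin) lee_fin => cb.
set bt := fine (beta P X 0) in small cb *.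
have n1 : (1 : R) <= n%:R by rewrite ler1n.
have nn : n%:R <= n%:R ^+ 2 :> R by rewrite expr2 ler_peMr// ltW// (lt_le_trans ltr01).
have c1 : mu [:: c] <= 1 := mu_le1 _ hX _.
have bt0 : 0 <= bt by apply: le_trans cb; rewrite subr_ge0.
have nbt : n%:R * bt <= n%:R ^+ 2 * bt by rewrite ler_wpM2r.
have nc : n%:R * (1 - mu [:: c]) <= n%:R * bt by rewrite ler_wpM2l//; lra.
pose Omega := [set x | segment X 1 n x = nseq n c].
have mOmega : measurable Omega by exact: measurable_segment.
have POmega : pr Omega = mu (nseq n c) by rewrite (mu_segment hstat 1) size_nseq.
exists Omega; split=> //.
  rewrite -(prK P (measurableC mOmega)) -EFinM lee_fin pr_setC// POmega.
  have : 0 <= n%:R * bt by rewrite mulr_ge0.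
  have := mu_nseq_ge n c; lra.
move=> y w y0 /andP[w_gt0 w_le1].
case: w w_gt0 w_le1 => // a [|//] _ _.
have mE : measurable (deviation_event n 0 0 t y [:: a] `&` Omega).
  by apply: measurableI => //; exact: measurable_deviation_event.
have [y4|y4] := leP (expR (- y)) (1 / 4); last first.
  by rewrite -prK// lee_fin; apply: le_trans (pr_le1 P mE) _; lra.
(* For [expR (- y) <= 1 / 4] no deviation occurs on [Omega], where [mu_hat] is explicit. It remains
   to compare squares, using [s >= 1] and [y >= 3 / 4]. *)
rewrite (_ : _ `&` _ = set0) ?measure0 ?lee_fin ?mulr_ge0 ?expR_ge0//.
apply/seteqP; split=> // x [/= + Xc]; apply/negP; rewrite -leNgt.
rewrite (mu_hat_constant _ tn Xc) /L_star.
have [y34 _] := expR_threshold y4.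
rewrite subrK addn0 mul0r mul0r addr0.
set s : R := fine _ + _; have s1 : 1 <= s by exact: (constant_ge1 P X hK).
set r : R := Num.sqrt _; have r0 : 0 <= r by exact: sqrtr_ge0.
have n0R : 0 < n%:R :> R by rewrite ltr0n.
have a0 : 0 <= mu [:: a] := mu_ge0 _ _ _.
apply: (@le_trans _ _ (4 * r)); last first.
  by rewrite ler_wpM2r// ler_peMr.
have r2 : (4 * r) ^+ 2 = 16 * (mu [:: a] * y / n%:R).
  rewrite exprMn sqr_sqrtr; first by ring.
  by rewrite divr_ge0 ?ler0n// mulr_ge0// ltW.
have tR : t%:R <= n%:R :> R by rewrite ler_nat.
have tR1 : n%:R - 1 <= t%:R :> R.
  by rewrite lerBlDr natr1 ler_nat; move: tn1; clear; lia.
have ay : mu [:: a] * (3 / 4) <= mu [:: a] * y by rewrite ler_wpM2l.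
rewrite -ler_sqr ?nnegrE ?mulr_ge0// r2 real_normK ?num_real//.
rewrite mulrA ler_pdivlMr//.
(* A letter other than [c] is estimated by 0, and its mass is at most [1 - mu [:: c]], hence at most
   [1 / n]. *)
have [ca|ca] := eqVneq c a; last first.
  rewrite muln0 mulr0 sub0r sqrrN.
  have ac : mu [:: a] <= 1 - mu [:: c].
    have := sum_mu_letter; rewrite (bigD1 c)//= (bigD1 a)//=; last by rewrite eq_sym.
    have : 0 <= \sum_(v | (v != c) && (v != a)) mu [:: v].
      by apply: sumr_ge0 => v _; exact: mu_ge0.
    lra.
  have na : n%:R * mu [:: a] <= 1.
    have : n%:R * mu [:: a] <= n%:R * (1 - mu [:: c]) by rewrite ler_wpM2l//; lra.
    lra.
  have : mu [:: a] * (n%:R * mu [:: a]) <= mu [:: a] * 1 by rewrite ler_wpM2l.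
  rewrite expr2; lra.
rewrite muln1 -ca in ay *.
(* For [c] itself the right side is bounded below since [mu [:: c] >= 1 / 2], while the error is at
   most [1 / n] because [t] and [n * mu [:: c]] differ by at most 1. *)
have c2 : 1 / 2 <= mu [:: c].
  have : bt <= n%:R * bt by rewrite ler_peMl.
  lra.
set e := n%:R^-1 * t%:R - mu [:: c].
have ne : n%:R * e = t%:R - n%:R * mu [:: c].
  by rewrite /e mulrBr mulVKf// gt_eqF.
have ne1 : -1 <= n%:R * e <= 1.
  have h : n%:R * mu [:: c] <= n%:R * 1 by rewrite ler_wpM2l//; lra.
  by rewrite ne; apply/andP; split; lra.
have ne2 : (n%:R * e) ^+ 2 <= 1.
  have /andP[h1 h2] := ne1; rewrite -subr_ge0 (_ : _ - _ = (1 - n%:R * e) * (1 + n%:R * e)).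
    by rewrite mulr_ge0; lra.
  by ring.
have e2 : e ^+ 2 * n%:R <= (n%:R * e) ^+ 2.
  by rewrite exprMn mulrC ler_wpM2r// sqr_ge0.
lra.
Qed.

End concentration.

Theorem theorem10 (R : realType) (A : finType) (disp : measure_display)
    (T : measurableType disp) (P : probability T R) (X : int -> T -> A)
    (K : (nat -> A) -> A -> R) (lambda : R) (n d q t : nat)
    (hX : is_process X)
    (hstat : stationary P X)
    (hK : transition_kernel K)
    (hcompat : compatible P X K)
    (hmix : phi_mixing P X)
    (hPhi : (Phi P X < +oo)%E)
    (hlambda1 : lambda < 1)
    (hlambda : forall (w : nat -> A) (a : A), K w a <= lambda)
    (hn : (0 < n)%N)
    (hd : (d <= n - 1)%N)
    (hq : q%:R <= (n%:R - 1) / 4 :> R)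
    (ht : t = (n - 1)%N \/ t = n)
    (hr : (d + q <= t)%N) :
  exists Omega_coup : set T,
    [/\ measurable Omega_coup,
        (P (~` Omega_coup) <= (2 * n%:R ^+ 2)%R%:E * beta P X q)%E &
        forall (y : R) (w : seq A), 0 < y -> (0 < size w <= d.+1)%N ->
          (P ([set x |
                (`|mu_hat R X n t w x - mu P X w| >
                  L_star P X lambda *
                    Num.sqrt (mu P X w * y / (n%:R - (size w)%:R + 1))
                  + (d + (d + q))%:R * y / (n%:R - (size w)%:R + 1))%R]
              `&` Omega_coup)
            <= (4 * expR (- y))%:E)%E].
Proof.
have tn : (n.-1 <= t <= n)%N by move: hn ht; clear; lia.
have dn : (d < n)%N by move: hn hd; clear; lia.
have N0 : 0 < 2 * n%:R ^+ 2 :> R by rewrite mulr_gt0// exprn_gt0// ltr0n.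
have beta0 : (0 <= beta P X q)%E by apply: beta_coef_ge0; exact: sigma_of_setT.
have [big|small] := leP 1%E ((2 * n%:R ^+ 2)%:E * beta P X q)%E.
  exists set0; split=> //; first by rewrite setC0 probability_setT.
  by move=> y w _ _; rewrite setI0 measure0 lee_fin mulr_ge0 ?expR_ge0.
(* Beta is extended-real; the value [+oo] falls under the previous case. *)
have beta_fin : beta P X q \is a fin_num.
  rewrite ge0_fin_numE// ltey; apply/negP => /eqP boo.
  by move: small; rewrite boo gt0_muley.
have [/eqP|dq_gt0] := posnP (d + q).
  rewrite addn_eq0 => /andP[/eqP d0 /eqP q0]; subst d q.
  apply: (constant_coupling hX hstat hK hlambda1 hlambda hn tn beta_fin).
  by rewrite -lte_fin EFinM fineK.
(* If [n = 1], then [d = 0] and [q >= 1], against [q <= (n - 1) / 4]. *)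
have n_gt1 : (1 < n)%N.
  rewrite ltnNge; apply/negP => n1.
  have q1 : 1 <= q%:R :> R.
    by rewrite ler1n; move: dq_gt0 dn n1; clear; lia.
  have : n%:R <= 1 :> R by rewrite lern1.
  by move: hq; lra.
exact: (block_coupling hX hstat hK hcompat hPhi hlambda1 hlambda
  n_gt1 dn tn dq_gt0 beta_fin).
Qed.
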